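(* Consider the stochastic gradient tracking iteration described in the context with stepsize $\alpha$, under the function, network and gradient-noise assumptions of the context with $\mu>0$, and let $\kappa=L/\mu$. If $$0<\alpha\le\bar\alpha:=\frac{\delta}{\sqrt{320}\,L\sqrt{Q\kappa}},$$ define $V_k=\widetilde X_k+\omega E_k$ with $\omega=\frac{16\alpha L}{\delta}$. Then, for every $k\ge 0$, $$V_{k+1}\le\Bigl(1-\frac{\mu\alpha}{2}\Bigr)V_k+\frac{\alpha^2\sigma^2}{N}+\frac{16\alpha^3LQ\sigma^2}{\delta}.$$
   Context: **Problem and algorithm.** $N,d\ge1$ are integers; agent $i\in\{1,\dots,N\}$ has a differentiable objective $f_i:\mathbb{R}^d\to\mathbb{R}$, $f_i(x)=\mathbb{E}[F_i(x;\xi_i)]$, and $f=\frac1N\sum_{i=1}^N f_i$. $\nabla F_i(x;\xi)$ is the stochastic gradient in $x$. Given mixing matrices $W_k=(w_{ij}^k)\in\mathbb{R}^{N\times N}$, stepsize $\alpha>0$, initial points $x_i^0\in\mathbb{R}^d$ and $g_i^0=\nabla F_i(x_i^0;\xi_i^0)$, stochastic gradient tracking is, for $k\ge0$, $$x_i^{k+1}=\sum_{j=1}^N w_{ij}^k(x_j^k-\alpha g_j^k),\qquad g_i^{k+1}=\sum_{j=1}^N w_{ij}^k g_j^k+\nabla F_i(x_i^{k+1};\xi_i^{k+1})-\nabla F_i(x_i^k;\xi_i^k).$$ **Function assumption.** Each $f_i$ is $L$-smooth (gradient $L$-Lipschitz) and $\mu$-strongly convex with $0<\mu\le L$. $f$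 admits a minimizer $x^\star$. **Network assumption.** $\{W_k\}_{k\ge0}$ is deterministic and each $W_k$ is nonnegative and doubly stochastic ($W_k\mathbf 1=\mathbf 1$, $\mathbf 1^{\mathsf T}W_k=\mathbf 1^{\mathsf T}$). With $\Pi=\frac1N\mathbf 1\mathbf 1^{\mathsf T}$ and $\widetilde W_k=W_k-\Pi$, there are an integer $\tau\ge1$ and $\lambda\in[0,1)$ with $\|\widetilde W_{k+\tau-1}\cdots\widetilde W_k\|_2\le\lambda$ for all $k\ge0$. Let $\Delta_\lambda=1-\lambda$. **Gradient-noise assumption.** $\mathcal F^k$ is the information ($\sigma$-algebra) available immediately before the samples $\xi_1^k,\dots,\xi_N^k$ are drawn; it contains the initialization and all iterates and samples generated up to iteration $k-1$ (so $x_i^k$ is $\mathcal F^k$-measurable). Conditioned on $\mathcal F^k$, the samples $\xi_1^k,\dots,\xi_N^k$ are mutually independent and, for every $i$, $\mathbb{E}[\nabla F_i(x_i^k;\xi_i^k)-\nabla f_i(x_i^k)\mid\mathcal F^k]=0$ and $\mathbb{E}[\|\nabla F_i(x_i^k;\xi_i^k)-\nabla f_i(x_i^k)\|^2\mid\mathcal F^k]\le\sigma^2$. The initial iterates $x_i^0$ are deterministic. **Notation.** Stack $\mathbf x^k=\mathrm{col}\{x_1^k,\dots,x_N^k\}$, $\mathbf g^k=\mathrm{col}\{g_i^k\}$, $\nabla\mathbf F(\mathbf x^k;\boldsymbol\xi^k)=\mathrm{col}\{\nabla F_i(x_i^k;\xi_i^k)\}$, $\nabla\mathbf f(\mathbf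 x)=\mathrm{col}\{\nabla f_i(x_i)\}$ in $\mathbb{R}^{Nd}$; $\mathbf x^\star=\mathbf 1\otimes x^\star$; $\mathbf\Pi=\Pi\otimes I_d$; $\widetilde{\mathbf W}_k=\widetilde W_k\otimes I_d$; $\bar x^k=\frac1N\sum_i x_i^k$; $\widehat{\mathbf x}^k=(\mathbf I-\mathbf\Pi)\mathbf x^k$; $\mathbf y^k=\mathbf g^k-\nabla\mathbf F(\mathbf x^k;\boldsymbol\xi^k)$; $\widetilde{\mathbf y}^k=\mathbf y^k+\nabla\mathbf f(\mathbf x^\star)$; $\eta=\frac{\Delta_\lambda}{2\tau}$; $\mathbf z^k=\frac{\alpha}{\eta}\widetilde{\mathbf y}^k$; $\delta=\frac{1-\lambda^2}{\tau}$; $Q=1+\frac{8}{\eta^2}=1+\frac{32\tau^2}{\Delta_\lambda^2}$. Let $\mathbf R_k=\delta\sum_{r=0}^\infty\mathbf\Psi(k+r,k)^{\mathsf T}\mathbf\Psi(k+r,k)$ with $\mathbf\Psi(t,s)=\widetilde{\mathbf W}_{t-1}\cdots\widetilde{\mathbf W}_s$ for $t>s$, $\mathbf\Psi(s,s)=\mathbf I$ (the series converges under the network assumption), and $\|\mathbf q\|_{\mathbf R}^2=\mathbf q^{\mathsf T}\mathbf R\mathbf q$. Define $$\widetilde X_k=\mathbb{E}\|\bar x^k-x^\star\|^2,\qquad E_k=\tfrac1N\mathbb{E}\bigl[\|\widehat{\mathbf x}^k\|_{\mathbf R_k}^2+2\|\mathbf z^k\|_{\mathbf R_k}^2\bigr].$$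 *)

(* Defs.v *)
From HB Require Import structures.
From mathcomp Require Import all_boot all_order all_algebra.
From mathcomp Require Import mathcomp_extra boolp classical_sets functions.
From mathcomp Require Import reals ereal topology normedtype sequences derive.
From mathcomp Require Import measure numfun lebesgue_measure lebesgue_integral.
From mathcomp Require Import probability.
From mathcomp.real_closed Require Export mxtens.

Set Implicit Arguments.
Unset Strict Implicit.
Unset Printing Implicit Defensive.

Import Order.TTheory GRing.Theory Num.Theory.
Import numFieldNormedType.Exports.

Local Open Scope classical_set_scope.
Local Open Scope ring_scope.

Section Euclidean.
Context {R : realType}.

(* The library norm on matrices is the sup norm, hence these definitions. *)
Definition l2norm n (v : 'cV[R]_n) : R := Num.sqrt (\sum_i v i 0 ^+ 2).

Definition opnorm2 m n (A : 'M[R]_(m, n)) : R :=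
  sup [set l2norm (A *m v) | v in [set v : 'cV[R]_n | l2norm v <= 1]].

Definition qform n (A : 'M[R]_n) (q : 'cV[R]_n) : R := (q^T *m A *m q) 0 0.

(* Meaningful when [f] is differentiable at [x]. *)
Definition grad n (f : 'cV[R]_n -> R) (x : 'cV[R]_n) : 'cV[R]_n :=
  \col_j 'D_(delta_mx j 0) (f : 'cV[R]_n -> R^o) x.

Definition differentiable_everywhere n (f : 'cV[R]_n -> R) : Prop :=
  forall x, differentiable (f : 'cV[R]_n -> R^o) x.

Definition smooth n (L : R) (f : 'cV[R]_n -> R) : Prop :=
  forall x y, l2norm (grad f x - grad f y) <= L * l2norm (x - y).

Definition strongly_convex n (mu : R) (f : 'cV[R]_n -> R) : Prop :=
  forall (x y : 'cV[R]_n) (t : R), 0 <= t <= 1 ->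
    f (t *: x + (1 - t) *: y) <=
      t * f x + (1 - t) * f y - mu / 2 * t * (1 - t) * l2norm (x - y) ^+ 2.

End Euclidean.

Section Conditioning.
Context {R : realType} {dO : measure_display} {Omega : measurableType dO}.
Variable P : probability Omega R.

Definition sub_sigma_algebra (G : set (set Omega)) : Prop :=
  sigma_algebra setT G /\ G `<=` measurable.

Definition measurable_wrt (G : set (set Omega)) (dT : measure_display)
    (T : measurableType dT) (X : Omega -> T) : Prop :=
  forall B, measurable B -> G (X @^-1` B).

(* Borel measurability of a random vector, expressed on its coordinates. *)
Definition vmeasurable_wrt (G : set (set Omega)) n
    (X : Omega -> 'cV[R]_n) : Prop :=
  forall j, measurable_wrt G (fun w => X w j 0).

(* [Y] is a version of E[X | G]. *)
Definition is_cond_exp (G : set (set Omega)) (X Y : Omega -> R) : Prop :=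
  [/\ P.-integrable setT (EFin \o X),
      measurable_wrt G Y,
      P.-integrable setT (EFin \o Y) &
      forall A, G A ->
        (\int[P]_(w in A) (Y w)%:E = \int[P]_(w in A) (X w)%:E)%E].

(* [p i] is a version of P(X i \in B i | G); subfamilies are obtained by
   taking some of the [B i] to be the full set. *)
Definition cond_mutually_independent (G : set (set Omega))
    (I : finType) (dX : measure_display) (Xi : I -> measurableType dX)
    (X : forall i, Omega -> Xi i) : Prop :=
  forall B : (forall i, set (Xi i)), (forall i, measurable (B i)) ->
  exists p : I -> Omega -> R,
    (forall i, is_cond_exp G (\1_(X i @^-1` B i)) (p i)) /\
    is_cond_exp G (\1_[set w | forall i, B i (X i w)])
                  (fun w => \prod_i p i w).

End Conditioning.

Section Network.
Context {R : realType}.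
Variable N : nat.

Definition avg_mx : 'M[R]_N := N%:R^-1 *: const_mx 1.

Definition doubly_stochastic (A : 'M[R]_N) : Prop :=
  [/\ forall i j, 0 <= A i j,
      A *m const_mx 1 = const_mx 1 :> 'cV[R]_N &
      const_mx 1 *m A = const_mx 1 :> 'rV[R]_N].

(* A_(t-1) *m ... *m A_s, and the identity when t <= s. *)
Definition backward_prod n (A : nat -> 'M[R]_n) (t s : nat) : 'M[R]_n :=
  \big[mulmx/1%:M]_(i <- rev (index_iota s t)) A i.

Definition network_assumption (W : nat -> 'M[R]_N) (tau : nat) (lambda : R)
    : Prop :=
  [/\ forall k, doubly_stochastic (W k),
      (1 <= tau)%N,
      0 <= lambda < 1 &
      forall k, opnorm2 (backward_prod (fun t => W t - avg_mx) (k + tau) k)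
                  <= lambda].

Definition eta (tau : nat) (lambda : R) : R := (1 - lambda) / (2 * tau%:R).
Definition delta (tau : nat) (lambda : R) : R := (1 - lambda ^+ 2) / tau%:R.
Definition Qcst (tau : nat) (lambda : R) : R := 1 + 8 / eta tau lambda ^+ 2.

Definition alpha_bar (L mu : R) (tau : nat) (lambda : R) : R :=
  delta tau lambda /
    (Num.sqrt 320 * L * Num.sqrt (Qcst tau lambda * (L / mu))).

Variable d : nat.

(* col{u_1, ..., u_N} in R^(Nd), indexed compatibly with the Kronecker
   product [*t]: ((A *t 1%:M) *m stack u) = stack (fun i => \sum_j A i j *: u j). *)
Definition stack (u : 'I_N -> 'cV[R]_d) : 'cV[R]_(N * d) :=
  \col_l u (mxtens_unindex l).1 (mxtens_unindex l).2 0.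

Definition Psi (W : nat -> 'M[R]_N) (t s : nat) : 'M[R]_(N * d) :=
  backward_prod (fun k => (W k - avg_mx) *t (1%:M : 'M[R]_d)) t s.

Definition Rmx (W : nat -> 'M[R]_N) (tau : nat) (lambda : R) (k : nat)
    : 'M[R]_(N * d) :=
  delta tau lambda *:
    limn (series (fun r => (Psi W (k + r) k)^T *m Psi W (k + r) k)).

Definition average (u : 'I_N -> 'cV[R]_d) : 'cV[R]_d :=
  N%:R^-1 *: \sum_i u i.

Definition consensus_error (u : 'I_N -> 'cV[R]_d) : 'cV[R]_(N * d) :=
  (1%:M - avg_mx *t (1%:M : 'M[R]_d)) *m stack u.

End Network.

Section GradientTracking.
Context {R : realType} (N d : nat).
Context {dO dX : measure_display} {Omega : measurableType dO}.
Context {Xi : 'I_N -> measurableType dX}.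
Variable P : probability Omega R.
(* [D i] is the law of the generic sample xi_i defining f_i. *)
Variable D : forall i, probability (Xi i) R.
Variable F : forall i, 'cV[R]_d -> Xi i -> R.

Definition local_objective (i : 'I_N) (x : 'cV[R]_d) : R :=
  \int[D i]_s F x s.

Definition global_objective (x : 'cV[R]_d) : R :=
  N%:R^-1 * \sum_i local_objective i x.

Definition stoch_grad (i : 'I_N) (x : 'cV[R]_d) (s : Xi i) : 'cV[R]_d :=
  grad (fun y => F y s) x.

(* Well-posedness of f_i(x) = E[F_i(x; xi_i)] and of the stochastic gradient.
   Joint measurability is stated with R^d encoded as [d.-tuple R], which
   carries the product (Borel) sigma-algebra. *)
Definition sampling_model : Prop :=
  forall i : 'I_N,
  [/\ forall x : 'cV[R]_d, (D i).-integrable setT (EFin \o @F i x),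
      forall s : Xi i, differentiable_everywhere (fun x => F x s) &
      forall j : 'I_d,
        measurable_fun [set: d.-tuple R * Xi i]
          (fun p => stoch_grad (\col_l tnth p.1 l) p.2 j 0)].

Definition function_assumption (L mu : R) : Prop :=
  0 < mu <= L /\
  forall i, [/\ differentiable_everywhere (local_objective i),
                smooth L (local_objective i) &
                strongly_convex mu (local_objective i)].

Definition is_minimizer (xstar : 'cV[R]_d) : Prop :=
  forall x, global_objective xstar <= global_objective x.

Variables (W : nat -> 'M[R]_N) (alpha : R) (x0 : 'I_N -> 'cV[R]_d).
Variable xi : nat -> forall i : 'I_N, Omega -> Xi i.
Variables x g : nat -> 'I_N -> Omega -> 'cV[R]_d.

Definition oracle (k : nat) (i : 'I_N) (w : Omega) : 'cV[R]_d :=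
  stoch_grad (x k i w) (xi k i w).

Definition sgt_iteration : Prop :=
  [/\ forall i w, x 0%N i w = x0 i,
      forall i w, g 0%N i w = oracle 0 i w,
      forall k i w,
        x k.+1 i w = \sum_j W k i j *: (x k j w - alpha *: g k j w) &
      forall k i w,
        g k.+1 i w = \sum_j W k i j *: g k j w
                     + oracle k.+1 i w - oracle k i w].

Definition noise (k : nat) (i : 'I_N) (w : Omega) : 'cV[R]_d :=
  oracle k i w - grad (local_objective i) (x k i w).

Definition noise_assumption (Fil : nat -> set (set Omega)) (sigma : R)
    : Prop :=
  forall k,
  [/\ sub_sigma_algebra (Fil k) /\
      (forall i, vmeasurable_wrt (Fil k) (x k i)) /\
      (forall s i, (s < k)%N ->
        [/\ measurable_wrt (Fil k) (xi s i),
            vmeasurable_wrt (Fil k) (x s i) &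
            vmeasurable_wrt (Fil k) (g s i)]),
      cond_mutually_independent P (Fil k) (xi k),
      forall i j, is_cond_exp P (Fil k) (fun w => noise k i w j 0) (cst 0) &
      forall i, exists Y : Omega -> R,
        is_cond_exp P (Fil k) (fun w => l2norm (noise k i w) ^+ 2) Y /\
        {ae P, forall w, Y w <= sigma ^+ 2}].

Variables (tau : nat) (lambda : R) (xstar : 'cV[R]_d).

Definition ytilde (k : nat) (w : Omega) : 'cV[R]_(N * d) :=
  stack (g k ^~ w) - stack (oracle k ^~ w)
  + stack (fun i => grad (local_objective i) xstar).

Definition zvec (k : nat) (w : Omega) : 'cV[R]_(N * d) :=
  (alpha / eta tau lambda) *: ytilde k w.

Definition Xtilde (k : nat) : \bar R :=
  ('E_P[fun w => (l2norm (average (x k ^~ w) - xstar) ^+ 2)%R])%E.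

Definition Eerr (k : nat) : \bar R :=
  ((N%:R^-1)%:E *
   'E_P[fun w => (qform (Rmx d W tau lambda k) (consensus_error (x k ^~ w))
                  + 2 * qform (Rmx d W tau lambda k) (zvec k w))%R])%E.

Definition Vlyap (L : R) (k : nat) : \bar R :=
  (Xtilde k + (16 * alpha * L / delta tau lambda)%:E * Eerr k)%E.

End GradientTracking.

(* Main.v *)
Require Import Defs.
From mathcomp Require Import all_boot all_order all_algebra.
From mathcomp Require Import finmap.
From mathcomp Require Import mathcomp_extra boolp classical_sets functions.
From mathcomp Require Import cardinality.
From mathcomp Require Import reals ereal normedtype sequences derive.
From mathcomp Require Import measure numfun measurable_realfun.
From mathcomp Require Import lebesgue_measure lebesgue_integral.
From mathcomp Require Import probability.
From mathcomp Require Import ring lra.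

Set Implicit Arguments.
Unset Strict Implicit.
Unset Printing Implicit Defensive.

Import Order.TTheory GRing.Theory Num.Theory.
Import numFieldNormedType.Exports.
Local Open Scope classical_set_scope.
Local Open Scope ring_scope.

(** One step of the iteration is split into its value for exact gradients plus the
    effect of the noise [s]. Write [b] for the stacked differences between the
    gradients at the iterates and at [xstar], [Wt = W - Pi], and [R] for the weight
    matrices. As the trackers always sum to the current stochastic gradients, the
    disagreement [xh], the scaled tracking error [z] and the mean [m] obey
[[
      xh' = Wt (xh - eta z - alpha (b + s))
      z'  = Wt z - (alpha / eta) (I - W) (b + s)
      m'  = m - alpha (average gradient + average noise).
]]

    The weights turn the contraction over [tau] steps into one over a single step:
    the series defining [R_k] satisfies [R_k = delta I + Wt^T R_(k+1) Wt]
    ([Rmx_lyapunov]), and summing it by blocks of length [tau] gives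
    [R_k <= I]. Hence [|Wt v|_R'^2 = |v|_R^2 - delta |v|^2], and Young's
    inequality yields a decrease of the weighted energy up to a term of order
    [alpha^2 Q / delta * |b|^2] ([lyapunov_step]).

    The mean follows an inexact gradient method on the global objective. The descent
    lemma at [m] and first-order strong convexity at [xstar], both written at the
    local iterates, give contraction by [1 - mu alpha] up to a term of order
    [alpha L] times the mean squared disagreement ([mean_step]). With
    [|b|^2 <= L^2 * sum_i |x_i - xstar|^2], the weight [omega] and the stepsize bound
    absorb both coupling terms and keep the factor [1 - mu alpha / 2], for every
    outcome ([combine_steps]).

    It remains to average over the noise. All iterates are square integrable, so the
    terms linear in the noise have zero expectation: their other factor is
    determined by the past ([noise_orthogonal]). The quadratic terms give [sigma^2 / N]
    for the mean, because conditional independence makes the noises of two agents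
    uncorrelated ([noise_uncorrelated]), and [Q sigma^2] for the energy
    ([noise_step]). The lack of correlation is the delicate measure-theoretic point:
    the noise of an agent is a function of both its sample and the past, so
    the product rule for events of the samples has to be extended by a pi-lambda
    argument ([cond_indep_uncorrelated]). *)

(** * Bilinear forms and stacked vectors *)

Definition bil {R : realType} n (A : 'M[R]_n) (p q : 'cV[R]_n) : R :=
  (p^T *m A *m q) 0 0.

Definition dot {R : realType} n (p q : 'cV[R]_n) : R := (p^T *m q) 0 0.

Section Bilinear.
Context {R : realType}.
Implicit Types n : nat.

Lemma qformE n (A : 'M[R]_n) q : qform A q = bil A q q.
Proof. by []. Qed.

Lemma bilDl n (A : 'M[R]_n) p1 p2 q :
  bil A (p1 + p2) q = bil A p1 q + bil A p2 q.
Proof. by rewrite /bil linearD /= !mulmxDl mxE. Qed.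

Lemma bilDr n (A : 'M[R]_n) p q1 q2 :
  bil A p (q1 + q2) = bil A p q1 + bil A p q2.
Proof. by rewrite /bil mulmxDr mxE. Qed.

Lemma bilZl n (A : 'M[R]_n) c p q : bil A (c *: p) q = c * bil A p q.
Proof. by rewrite /bil linearZ /= -!scalemxAl mxE. Qed.

Lemma bilZr n (A : 'M[R]_n) c p q : bil A p (c *: q) = c * bil A p q.
Proof. by rewrite /bil -scalemxAr mxE. Qed.

Lemma bilNl n (A : 'M[R]_n) p q : bil A (- p) q = - bil A p q.
Proof. by rewrite -scaleN1r bilZl mulN1r. Qed.

Lemma bilNr n (A : 'M[R]_n) p q : bil A p (- q) = - bil A p q.
Proof. by rewrite -scaleN1r bilZr mulN1r. Qed.

Lemma bil_sym n (A : 'M[R]_n) p q : A^T = A -> bil A p q = bil A q p.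
Proof.
move=> sA; rewrite /bil -[in LHS](trmxK (p^T *m A *m q)) mxE.
by rewrite !trmx_mul trmxK sA mulmxA.
Qed.

Lemma dot_bil n (p q : 'cV[R]_n) : dot p q = bil 1%:M p q.
Proof. by rewrite /bil mulmx1. Qed.

Lemma dotE n (p q : 'cV[R]_n) : dot p q = \sum_i p i 0 * q i 0.
Proof. by rewrite /dot mxE; apply: eq_bigr => i _; rewrite mxE. Qed.

Lemma dotC n (p q : 'cV[R]_n) : dot p q = dot q p.
Proof. by rewrite !dotE; apply: eq_bigr => i _; rewrite mulrC. Qed.

Lemma dotDl n (p1 p2 q : 'cV[R]_n) : dot (p1 + p2) q = dot p1 q + dot p2 q.
Proof. by rewrite !dot_bil bilDl. Qed.

Lemma dotDr n (p q1 q2 : 'cV[R]_n) : dot p (q1 + q2) = dot p q1 + dot p q2.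
Proof. by rewrite !dot_bil bilDr. Qed.

Lemma dotZl n c (p q : 'cV[R]_n) : dot (c *: p) q = c * dot p q.
Proof. by rewrite !dot_bil bilZl. Qed.

Lemma dotZr n c (p q : 'cV[R]_n) : dot p (c *: q) = c * dot p q.
Proof. by rewrite !dot_bil bilZr. Qed.

Lemma dotNl n (p q : 'cV[R]_n) : dot (- p) q = - dot p q.
Proof. by rewrite !dot_bil bilNl. Qed.

Lemma dotNr n (p q : 'cV[R]_n) : dot p (- q) = - dot p q.
Proof. by rewrite !dot_bil bilNr. Qed.

Lemma dot_mull m n (A : 'M[R]_(m, n)) p q : dot (A *m p) q = dot p (A^T *m q).
Proof. by rewrite /dot trmx_mul mulmxA. Qed.

Lemma dot0l n (q : 'cV[R]_n) : dot 0 q = 0.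
Proof. by rewrite /dot trmx0 mul0mx mxE. Qed.

Lemma dot_suml n (I : finType) (u : I -> 'cV[R]_n) q :
  dot (\sum_i u i) q = \sum_i dot (u i) q.
Proof. by rewrite /dot linear_sum /= mulmx_suml summxE. Qed.

Lemma dot_ge0 n (p : 'cV[R]_n) : 0 <= dot p p.
Proof. by rewrite dotE sumr_ge0 // => i _; rewrite -expr2 sqr_ge0. Qed.

Lemma dot_eq0 n (p : 'cV[R]_n) : dot p p = 0 -> p = 0.
Proof.
rewrite dotE => /eqP; rewrite psumr_eq0 => [/allP p0|i _]; last first.
  by rewrite -expr2 sqr_ge0.
apply/colP => i; rewrite mxE; apply/eqP.
by have := p0 i (mem_index_enum _); rewrite -expr2 sqrf_eq0.
Qed.

Lemma l2norm_sqr n (p : 'cV[R]_n) : l2norm p ^+ 2 = dot p p.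
Proof.
rewrite /l2norm sqr_sqrtr ?dotE; first by apply: eq_bigr => i _; rewrite expr2.
by rewrite sumr_ge0 // => i _; rewrite sqr_ge0.
Qed.

Lemma l2norm_ge0 n (p : 'cV[R]_n) : 0 <= l2norm p.
Proof. by rewrite /l2norm sqrtr_ge0. Qed.

Lemma bil_young n (A : 'M[R]_n) (c : R) p q :
  A^T = A -> (forall v, 0 <= qform A v) -> 0 < c ->
  qform A (p + q) <= (1 + c) * qform A p + (1 + c^-1) * qform A q.
Proof.
move=> sA A_ge0 c_gt0.
have := A_ge0 (c *: p - q); rewrite !qformE !(bilDl, bilDr, bilNl, bilNr, bilZl, bilZr).
rewrite (bil_sym q p sA) => h.
rewrite -subr_ge0 -(pmulr_rge0 _ c_gt0).
by move: h; congr (0 <= _); field; rewrite gt_eqF.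
Qed.

Lemma dot_young n (c : R) (p q : 'cV[R]_n) : 0 < c ->
  dot (p + q) (p + q) <= (1 + c) * dot p p + (1 + c^-1) * dot q q.
Proof.
move=> c_gt0; rewrite !dot_bil; apply: bil_young => //; first exact: trmx1.
by move=> v; rewrite qformE -dot_bil dot_ge0.
Qed.

Lemma dot_two n (p q : 'cV[R]_n) :
  dot (p + q) (p + q) <= 2 * dot p p + 2 * dot q q.
Proof. by have := @dot_young _ 1 p q ltr01; rewrite invr1. Qed.

Lemma dot_amgm n (c : R) (p q : 'cV[R]_n) : 0 < c ->
  2 * dot p q <= c * dot p p + c^-1 * dot q q.
Proof.
move=> c_gt0; have := @dot_young _ c p q c_gt0.
by rewrite !(dotDl, dotDr) (dotC q p); lra.
Qed.

(** Jensen's inequality, read off from the nonnegativity of the sum of the squared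
    deviations from the average. *)
Lemma dot_average_le N d (u : 'I_N -> 'cV[R]_d) : (0 < N)%N ->
  dot (average u) (average u) <= N%:R^-1 * \sum_i dot (u i) (u i).
Proof.
move=> N0; have N0' : 0 < N%:R :> R by rewrite ltr0n.
have : \sum_i u i = N%:R *: average u.
  by rewrite /average scalerA mulfV ?scale1r// gt_eqF.
move: (average u) => m um.
have : 0 <= \sum_i dot (u i - m) (u i - m).
  by apply: sumr_ge0 => i _; exact: dot_ge0.
under eq_bigr => i _ do rewrite dotDl !dotDr !dotNr !dotNl (dotC m) opprK.
rewrite !big_split /= !sumrN sumr_const card_ord -!dot_suml um !dotZl -(mulr_natr (dot m m)) => h.
have -> : dot m m = N%:R^-1 * (N%:R * dot m m) by rewrite mulrA mulVf ?mul1r// gt_eqF.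
by rewrite ler_wpM2l ?invr_ge0 ?ler0n//; lra.
Qed.

End Bilinear.

Section Stack.
Context {R : realType} (N d : nat).
Implicit Types (A : 'M[R]_N) (u : 'I_N -> 'cV[R]_d).

Definition kron A : 'M[R]_(N * d) := A *t (1%:M : 'M[R]_d).

Definition unstack (q : 'cV[R]_(N * d)) : 'I_N -> 'cV[R]_d :=
  fun i => \col_l q (mxtens_index (i, l)) 0.

Lemma stackE u i l : stack u (mxtens_index (i, l)) 0 = u i l 0.
Proof. by rewrite mxE mxtens_indexK. Qed.

Lemma stack_ext (p q : 'cV[R]_(N * d)) :
  (forall i l, p (mxtens_index (i, l)) 0 = q (mxtens_index (i, l)) 0) -> p = q.
Proof.
move=> pq; apply/colP => k; rewrite -(mxtens_unindexK k).
by case: (mxtens_unindex k).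
Qed.

Lemma unstackK q : stack (unstack q) = q.
Proof. by apply: stack_ext => i l; rewrite stackE mxE. Qed.

Lemma stack_eq u v : (forall i, u i = v i) -> stack u = stack v.
Proof. by move=> uv; congr stack; apply/funext. Qed.

Lemma stackD u v : stack u + stack v = stack (fun i => u i + v i).
Proof. by apply: stack_ext => i l; rewrite !mxE !mxtens_indexK /= ?mxE. Qed.

Lemma stackB u v : stack u - stack v = stack (fun i => u i - v i).
Proof. by apply: stack_ext => i l; rewrite !mxE !mxtens_indexK /= ?mxE. Qed.

Lemma stackZ c u : c *: stack u = stack (fun i => c *: u i).
Proof. by apply: stack_ext => i l; rewrite !mxE !mxtens_indexK /= ?mxE. Qed.

Lemma big_mxtens (F : 'I_(N * d) -> R) :
  \sum_k F k = \sum_i \sum_l F (mxtens_index (i, l)).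
Proof.
rewrite pair_bigA /= (reindex (@mxtens_index N d)) /=.
  by apply: eq_bigr => -[i l].
exists (@mxtens_unindex N d) => k _; [exact: mxtens_indexK|exact: mxtens_unindexK].
Qed.

Lemma kron_stack A u : kron A *m stack u = stack (fun i => \sum_j A i j *: u j).
Proof.
apply: stack_ext => i l; rewrite stackE summxE mxE big_mxtens.
apply: eq_bigr => j _; rewrite (bigD1 l) //= big1 ?addr0 => [|l' l'l].
  by rewrite stackE tensmxE !mxE eqxx mulr1.
by rewrite tensmxE !mxE eq_sym (negbTE l'l) mulr0 mul0r.
Qed.

Lemma kronM A B : kron A *m kron B = kron (A *m B).
Proof. by rewrite /kron tensmx_mul mulmx1. Qed.

Lemma kronB A B : kron A - kron B = kron (A - B).
Proof.
apply/matrixP => a b; rewrite -(mxtens_unindexK a) -(mxtens_unindexK b).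
case: (mxtens_unindex a) => i l; case: (mxtens_unindex b) => j l'.
rewrite [LHS]mxE [X in _ + X]mxE !tensmxE [(A - B) i j]mxE [(- B) i j]mxE.
by rewrite mulrDl mulNr.
Qed.

Lemma kron1 : kron 1%:M = 1%:M.
Proof.
apply/matrixP => a b; rewrite -(mxtens_unindexK a) -(mxtens_unindexK b).
case: (mxtens_unindex a) => i l; case: (mxtens_unindex b) => j l'.
rewrite tensmxE !mxE (can_eq (@mxtens_indexK _ _)) xpair_eqE -natrM mulnb.
by [].
Qed.

Lemma dot_stack u v : dot (stack u) (stack v) = \sum_i dot (u i) (v i).
Proof.
rewrite dotE big_mxtens; apply: eq_bigr => i _; rewrite dotE.
by apply: eq_bigr => l _; rewrite !stackE.
Qed.

(** Squared norms split over the d coordinates, on each of which the stacked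
    operator acts as [A] itself. *)
Lemma kron_bound A c :
  (forall v : 'cV[R]_N, dot (A *m v) (A *m v) <= c * dot v v) ->
  forall q, dot (kron A *m q) (kron A *m q) <= c * dot q q.
Proof.
move=> Ac q; rewrite -(unstackK q); set u := unstack q.
rewrite kron_stack !dot_stack.
under eq_bigr => i _ do rewrite dotE.
under [X in _ <= c * X]eq_bigr => i _ do rewrite dotE.
rewrite exchange_big [X in _ <= c * X]exchange_big mulr_sumr /=.
apply: ler_sum => l _; have := Ac (\col_i u i l 0).
rewrite !dotE.
under [X in X <= _ -> _]eq_bigr => i _ do rewrite mxE.
have E i : \sum_j A i j * (\col_i0 u i0 l 0) j 0 = (\sum_j A i j *: u j) l 0.
  by rewrite summxE; apply: eq_bigr => j _; rewrite !mxE.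
under [X in X <= _ -> _]eq_bigr => i _ do rewrite E.
by under [X in _ <= _ * X -> _]eq_bigr => i _ do rewrite mxE.
Qed.

End Stack.

(** * Doubly stochastic matrices and the weight matrices *)

Section Network.
Context {R : realType}.
Implicit Types N d n : nat.

Lemma ds_row_sum N (A : 'M[R]_N) i : doubly_stochastic A -> \sum_j A i j = 1.
Proof.
case=> _ /(congr1 (fun M : 'cV[R]_N => M i 0)) + _; rewrite !mxE => <-.
by apply: eq_bigr => j _; rewrite mxE mulr1.
Qed.

Lemma ds_col_sum N (A : 'M[R]_N) j : doubly_stochastic A -> \sum_i A i j = 1.
Proof.
case=> _ _ /(congr1 (fun M : 'rV[R]_N => M 0 j)); rewrite !mxE => <-.
by apply: eq_bigr => i _; rewrite mxE mul1r.
Qed.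

Lemma avg_mx_mulr N (A : 'M[R]_N) : doubly_stochastic A ->
  avg_mx N *m A = avg_mx N.
Proof.
move=> dsA; apply/matrixP => i j; rewrite !mxE mulr1 -[RHS]mulr1.
rewrite -[X in _ * X](ds_col_sum j dsA) mulr_sumr.
by apply: eq_bigr => l _; rewrite !mxE mulr1.
Qed.

Lemma avg_mx_mull N (A : 'M[R]_N) : doubly_stochastic A ->
  A *m avg_mx N = avg_mx N.
Proof.
move=> dsA; apply/matrixP => i j; rewrite !mxE mulr1 -[RHS]mul1r.
rewrite -[X in X * _](ds_row_sum i dsA) mulr_suml.
by apply: eq_bigr => l _; rewrite !mxE mulr1.
Qed.

Lemma avg_mx_idem N : (0 < N)%N -> avg_mx N *m avg_mx N = avg_mx N :> 'M[R]_N.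
Proof.
move=> N0; apply/matrixP => i j; rewrite !mxE mulr1.
under eq_bigr => l _ do rewrite !mxE mulr1.
rewrite sumr_const card_ord -(mulr_natr (_ * _)) -mulrA mulVf ?mulr1//.
by rewrite pnatr_eq0 -lt0n.
Qed.

(** Jensen along each row, then the columns sum to one. *)
Lemma ds_nonexpansive N (A : 'M[R]_N) : doubly_stochastic A ->
  forall v, dot (A *m v) (A *m v) <= dot v v.
Proof.
move=> dsA v; have [A_ge0 _ _] := dsA; rewrite !dotE.
have row i : (A *m v) i 0 * (A *m v) i 0 <= \sum_j A i j * (v j 0 * v j 0).
  set m := (A *m v) i 0.
  have : 0 <= \sum_j A i j * (v j 0 - m) ^+ 2.
    by apply: sumr_ge0 => j _; rewrite mulr_ge0 ?sqr_ge0.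
  have -> : \sum_j A i j * (v j 0 - m) ^+ 2 =
      \sum_j A i j * (v j 0 * v j 0) - 2 * m * \sum_j A i j * v j 0
      + m * m * \sum_j A i j.
    rewrite !mulr_sumr -sumrB -big_split /=.
    by apply: eq_bigr => j _; ring.
  have -> : \sum_j A i j * v j 0 = m by rewrite /m mxE.
  by rewrite ds_row_sum//; lra.
apply: le_trans (ler_sum _ (fun i _ => row i)) _.
rewrite exchange_big /=; apply: ler_sum => j _.
by rewrite -mulr_suml ds_col_sum// mul1r.
Qed.

(** Subtracting the mean of [A v] can only decrease its norm. *)
Lemma ds_centered_nonexpansive N (A : 'M[R]_N) : doubly_stochastic A ->
  forall v, dot ((A - avg_mx N) *m v) ((A - avg_mx N) *m v) <= dot v v.
Proof.
move=> dsA v; apply: le_trans _ (ds_nonexpansive dsA v).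
rewrite mulmxBl; set p := A *m v; set q := avg_mx N *m v.
have qE : q = avg_mx N *m p by rewrite /p mulmxA avg_mx_mulr.
have pq : dot p q = dot q q.
  case: N A dsA v @p @q qE => [|N] A dsA v p q qE.
    by rewrite !dotE !big_ord0.
  rewrite qE [RHS]dot_mull.
  have -> : (avg_mx N.+1)^T = avg_mx N.+1 :> 'M[R]__.
    by apply/matrixP => i j; rewrite !mxE.
  by rewrite [in RHS]mulmxA avg_mx_idem.
rewrite !(dotDl, dotDr, dotNl, dotNr) opprK (dotC q p) pq.
by have := dot_ge0 q; lra.
Qed.

Lemma opnorm2_bound n (A : 'M[R]_n) (c : R) :
  (forall v, dot (A *m v) (A *m v) <= dot v v) -> 0 <= c -> opnorm2 A <= c ->
  forall v, dot (A *m v) (A *m v) <= c ^+ 2 * dot v v.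
Proof.
move=> A1 c0 Ac v.
have [/dot_eq0 ->|v0] := eqVneq (dot v v) 0.
  by rewrite mulmx0 !dotE big1 ?mulr0// => i _; rewrite mxE mulr0.
have nv0 : l2norm v != 0 by apply: contra v0; rewrite -l2norm_sqr sqrf_eq0.
set u := (l2norm v)^-1 *: v.
have u1 : dot u u = 1.
  by rewrite dotZl dotZr -l2norm_sqr; field.
have : l2norm (A *m u) <= c.
  apply: le_trans _ Ac; apply: ub_le_sup.
    exists 1 => _ [w /= w1 <-].
    rewrite -(@ler_pXn2r _ 2)// ?nnegrE ?l2norm_ge0// expr1n l2norm_sqr.
    apply: le_trans (A1 w) _.
    by rewrite -l2norm_sqr expr_le1// l2norm_ge0.
  exists u => //=.
  by rewrite -(@ler_pXn2r _ 2)// ?nnegrE ?l2norm_ge0// expr1n l2norm_sqr u1.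
rewrite -(@ler_pXn2r _ 2)// ?nnegrE ?l2norm_ge0// l2norm_sqr.
rewrite /u -scalemxAr dotZl dotZr mulrA -expr2 exprVn mulrC.
rewrite ler_pdivrMr -?l2norm_sqr//.
by rewrite lt_neqAle sqr_ge0 andbT eq_sym sqrf_eq0.
Qed.

Section BackwardProd.
Variables (n : nat) (A : nat -> 'M[R]_n).

Lemma backward_prod_id s : backward_prod A s s = 1%:M.
Proof. by rewrite /backward_prod /index_iota subnn big_nil. Qed.

Lemma backward_prod_cat s a b :
  backward_prod A (s + (a + b)) s =
  backward_prod A (s + a + b) (s + a) *m backward_prod A (s + a) s.
Proof.
rewrite /backward_prod /index_iota addnA !addKn -addnA addKn iotaD rev_cat.
elim: (rev (iota (s + a) b)) => [|i l IH] /=; first by rewrite big_nil mul1mx.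
by rewrite !big_cons IH mulmxA.
Qed.

Lemma backward_prod_recr s r :
  backward_prod A (s + r.+1) s = backward_prod A (s.+1 + r) s.+1 *m A s.
Proof.
rewrite -add1n backward_prod_cat addn1; congr (_ *m _).
by rewrite /backward_prod /index_iota subSnn /= big_cons big_nil mulmx1.
Qed.

Lemma backward_prod_nonexpansive t s :
  (forall k v, dot (A k *m v) (A k *m v) <= dot v v) ->
  forall v, dot (backward_prod A t s *m v) (backward_prod A t s *m v) <= dot v v.
Proof.
move=> A1; rewrite /backward_prod; elim: (rev _) => [v|i l IH v].
  by rewrite big_nil mul1mx.
by rewrite big_cons -mulmxA; apply: le_trans (A1 _ _) (IH _).
Qed.

End BackwardProd.

End Network.

Section WeightMatrix.
Context {R : realType} (N d : nat).
Variables (W : nat -> 'M[R]_N) (tau : nat) (lambda : R).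
Hypothesis hW : network_assumption W tau lambda.

Local Notation Wt k := (kron d (W k - avg_mx N)).
Local Notation Psi := (Psi d W).
Local Notation Rk := (Rmx d W tau lambda).
Local Notation dlt := (delta tau lambda).
Local Notation sqn q := (dot q q).

Lemma tau_gt0 : 0 < tau%:R :> R.
Proof. by case: hW => _ t0 _ _; rewrite ltr0n. Qed.

Lemma lambda_bounds : 0 <= lambda < 1.
Proof. by case: hW. Qed.

Lemma lambda2_lt1 : 0 < 1 - lambda ^+ 2.
Proof. by case/andP: lambda_bounds => l0 l1; rewrite subr_gt0 expr_lt1. Qed.

Lemma delta_gt0 : 0 < dlt.
Proof. by rewrite divr_gt0 ?lambda2_lt1 ?tau_gt0. Qed.

Lemma ds_W k : doubly_stochastic (W k).
Proof. by case: hW. Qed.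

Lemma Wt_nonexpansive k q : sqn (Wt k *m q) <= sqn q.
Proof.
rewrite -[leRHS]mul1r; apply: kron_bound => v; rewrite mul1r.
exact/ds_centered_nonexpansive/ds_W.
Qed.

Lemma Psi_nonexpansive t s q : sqn (Psi t s *m q) <= sqn q.
Proof. by apply: backward_prod_nonexpansive => k v; exact: Wt_nonexpansive. Qed.

Lemma Psi_kron t s :
  Psi t s = kron d (backward_prod (fun k => W k - avg_mx N) t s).
Proof.
rewrite /Defs.Psi /backward_prod; elim: (rev _) => [|i l IH].
  by rewrite !big_nil kron1.
by rewrite !big_cons IH kronM.
Qed.

Lemma Psi_contraction k q : sqn (Psi (k + tau) k *m q) <= lambda ^+ 2 * sqn q.
Proof.
rewrite Psi_kron; apply: kron_bound => v.
have [_ _ /andP[l0 _] hl] := hW.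
apply: opnorm2_bound l0 (hl k) v => v; apply: backward_prod_nonexpansive => j u.
exact/ds_centered_nonexpansive/ds_W.
Qed.

(** Each block of [tau] steps contributes at most [tau] times the squared norm
    at its start, and these decrease geometrically with ratio [lambda ^+ 2]. *)
Lemma sum_Psi_le n k q :
  dlt * \sum_(0 <= r < n) sqn (Psi (k + r) k *m q) <= sqn q.
Proof.
rewrite mulrC /delta mulrA ler_pdivrMr ?tau_gt0//.
elim: n {-2}n (leqnn n) k q => [|m IH] n nm k q.
  by move: nm; rewrite leqn0 => /eqP ->; rewrite big_geq// mul0r mulr_ge0 ?dot_ge0.
have short j : (j <= tau)%N ->
    \sum_(0 <= r < j) sqn (Psi (k + r) k *m q) <= sqn q * tau%:R.
  move=> jt.
  have : \sum_(0 <= r < j) sqn (Psi (k + r) k *m q) <= \sum_(0 <= r < j) sqn q.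
    by apply: ler_sum => r _; exact: Psi_nonexpansive.
  move=> /le_trans; apply; rewrite sumr_const_nat subn0 -(mulr_natr (sqn q)).
  by rewrite ler_wpM2l ?dot_ge0// ler_nat.
have [ntau|/ltnW taun] := leqP n tau.
  apply: le_trans _ (short _ ntau); rewrite ler_piMr//.
    by apply: sumr_ge0 => r _; exact: dot_ge0.
  by rewrite gerBl sqr_ge0.
rewrite (@big_cat_nat _ _ _ tau) //=.
have t0 : (0 < tau)%N by case: hW.
have -> : \sum_(tau <= r < n) sqn (Psi (k + r) k *m q) =
    \sum_(0 <= r < n - tau) sqn (Psi (k + tau + r) (k + tau) *m (Psi (k + tau) k *m q)).
  rewrite -{1}(add0n tau) big_addn; apply: eq_bigr => r _.
  by rewrite addnC -(addnC tau) /Defs.Psi [(tau + r + k)%N]addnC backward_prod_cat mulmxA.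
have ntm : (n - tau <= m)%N by rewrite leq_subLR (leq_trans nm)// -add1n leq_add2r.
have h1 := IH _ ntm (k + tau)%N (Psi (k + tau) k *m q).
have h2 := short tau (leqnn _).
have h3 := Psi_contraction k q.
have h4 := lambda2_lt1.
have h5 : sqn (Psi (k + tau) k *m q) * tau%:R <= lambda ^+ 2 * sqn q * tau%:R.
  by rewrite ler_wpM2r// ltW// tau_gt0.
have h6 := ler_wpM2r (ltW h4) h2.
rewrite mulrDl; lra.
Qed.

Let gram k r := (Psi (k + r) k)^T *m Psi (k + r) k.

Let gram_qform k r q : qform (gram k r) q = sqn (Psi (k + r) k *m q).
Proof. by rewrite /qform /gram /dot trmx_mul !mulmxA. Qed.

Let gram_sym k r : (gram k r)^T = gram k r.
Proof. by rewrite /gram trmx_mul trmxK. Qed.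

Let series_sym k n : (series (gram k) n)^T = series (gram k) n.
Proof.
by rewrite /series /= linear_sum /=; apply: eq_bigr => r _; exact: gram_sym.
Qed.

Let series_qform k n q :
  qform (series (gram k) n) q = \sum_(0 <= r < n) sqn (Psi (k + r) k *m q).
Proof.
rewrite /series /= /qform mulmx_sumr mulmx_suml summxE.
by apply: eq_bigr => r _; exact: gram_qform.
Qed.

Let qform_cvg k q : cvgn (fun n => qform (series (gram k) n) q).
Proof.
apply: nondecreasing_is_cvgn.
  apply/nondecreasing_seqP => n; rewrite !series_qform big_nat_recr //=.
  by rewrite lerDl dot_ge0.
exists (dlt^-1 * sqn q) => _ [n _ <-].
rewrite series_qform -ler_pdivrMl ?invr_gt0 ?delta_gt0// invrK.
exact: sum_Psi_le.
Qed.

Let bil_delta n (A : 'M[R]_n) a b : bil A (delta_mx a 0) (delta_mx b 0) = A a b.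
Proof. by rewrite /bil trmx_delta -rowE -colE !mxE. Qed.

(* Polarization recovers the entries from the quadratic forms, which converge as
   bounded monotone sequences. *)
Let entry_cvg k a b : cvgn (fun n => series (gram k) n a b).
Proof.
pose e c : 'cV[R]_(N * d) := delta_mx c 0.
have -> : (fun n => series (gram k) n a b) = (fun n => 2^-1 *
    (qform (series (gram k) n) (e a + e b) - qform (series (gram k) n) (e a)
     - qform (series (gram k) n) (e b))).
  apply/funext => n; rewrite !qformE bilDl !bilDr (bil_sym (e b) (e a)) ?series_sym//.
  rewrite /e !bil_delta; lra.
apply: is_cvgMr; apply: is_cvgB; last exact: qform_cvg.
by apply: is_cvgB; exact: qform_cvg.
Qed.

Let Slim k : 'M[R]_(N * d) := \matrix_(a, b) limn (fun n => series (gram k) n a b).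

Let series_cvg k : series (gram k) @ \oo --> Slim k.
Proof.
apply/cvg_ballP => e e0.
have H a b : \forall n \near \oo, ball (Slim k a b) e (series (gram k) n a b).
  have /cvg_ballP/(_ _ e0) := @entry_cvg k a b.
  by rewrite /Slim mxE.
have : \forall n \near \oo, forall a b, ball (Slim k a b) e (series (gram k) n a b).
  by apply: filter_forall => a; apply: filter_forall => b.
by apply: filterS => n Hn; split.
Qed.

Lemma RmxE k : Rk k = dlt *: Slim k.
Proof.
by congr (_ *: _); apply: cvg_lim (@series_cvg k); exact: norm_hausdorff.
Qed.

Lemma Rmx_sym k : (Rk k)^T = Rk k.
Proof.
apply/matrixP => a b; rewrite RmxE !mxE; congr (_ * _).
have -> // : (fun n => series (gram k) n b a) = (fun n => series (gram k) n a b).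
by apply/funext => n; rewrite -[in LHS]series_sym [in LHS]mxE.
Qed.

Lemma Rmx_qform_cvg k q :
  (fun n => dlt * \sum_(0 <= r < n) sqn (Psi (k + r) k *m q)) @ \oo
    --> qform (Rk k) q.
Proof.
have -> : qform (Rk k) q = dlt * qform (Slim k) q.
  by rewrite RmxE /qform -scalemxAr -scalemxAl mxE.
apply: cvgMr; rewrite (_ : (fun n => _) = (fun n => qform (series (gram k) n) q)); last first.
  by apply/funext => n; rewrite series_qform.
have E (M : 'M[R]_(N * d)) : qform M q = \sum_a \sum_b q b 0 * M b a * q a 0.
  rewrite /qform mxE; apply: eq_bigr => a _; rewrite mxE mulr_suml.
  by apply: eq_bigr => b _; rewrite mxE.
rewrite E; under [X in X @ _ --> _]eq_fun do rewrite E.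
apply: cvg_big => [|a _]; first exact: add_continuous.
apply: cvg_big => [|b _]; first exact: add_continuous.
apply: cvgMl; apply: cvgMr.
rewrite mxE; exact: entry_cvg.
Qed.

(** The Lyapunov equation [R_k = delta I + Wt_k^T R_(k+1) Wt_k]: splitting off the
    first term of the series for [R_k] leaves the one for [R_(k+1)]. *)
Lemma Rmx_lyapunov k q :
  qform (Rk k.+1) (Wt k *m q) = qform (Rk k) q - dlt * sqn q.
Proof.
have := @Rmx_qform_cvg k q; rewrite -(cvg_shiftS _ _) => /(cvg_lim (@Rhausdorff R)) <-.
have := @Rmx_qform_cvg k.+1 (Wt k *m q) => H.
apply/eqP; rewrite eq_sym subr_eq; apply/eqP; apply: cvg_lim => //.
rewrite (_ : (fun n => _) = (fun n => dlt * \sum_(0 <= r < n)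
   sqn (Psi (k.+1 + r) k.+1 *m (Wt k *m q)) + dlt * sqn q)).
  by apply: cvgD H _; exact: cvg_cst.
apply/funext => n; rewrite big_nat_recl// -mulrDr addrC; congr (_ * (_ + _)).
  apply: eq_bigr => r _.
  by rewrite mulmxA /Defs.Psi -backward_prod_recr.
by rewrite addn0 /Defs.Psi backward_prod_id mul1mx.
Qed.

Lemma Rmx_le k q : qform (Rk k) q <= sqn q.
Proof.
apply: (@cvgr_to_le _ _ _ _ _ _ _ (@Rmx_qform_cvg k q)).
by apply: nearW => n; exact: sum_Psi_le.
Qed.

Lemma Rmx_ge0 k q : 0 <= qform (Rk k) q.
Proof.
apply: (@cvgr_to_ge _ _ _ _ _ _ _ (@Rmx_qform_cvg k q)).
apply: nearW => n; rewrite mulr_ge0 ?(ltW delta_gt0)//.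
by apply: sumr_ge0 => r _; exact: dot_ge0.
Qed.

End WeightMatrix.

(** * Smooth and strongly convex functions *)

Section Smooth.
Context {R : realType}.

(** The difference with the quadratic upper model has a nonpositive derivative. *)
Lemma taylor_upper (phi dphi : R -> R) (K : R) :
  (forall t : R, is_derive t 1 phi (dphi t)) ->
  (forall t, 0 < t < 1 -> dphi t - dphi 0 <= K * t) ->
  phi 1 <= phi 0 + dphi 0 + K / 2.
Proof.
move=> hphi hK.
pose psi (t : R) : R := phi t - (t * dphi 0 + K / 2 * t ^+ 2).
have hpsi (t : R) : is_derive t 1 psi (dphi t - (dphi 0 + K * t)).
  rewrite /psi; apply: is_derive_eq.
  by rewrite /GRing.scale /=; field.
have : psi 1 <= psi 0.
  apply: (@ler0_derive1_le_cc _ psi 0 1) => //.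
  - move=> t t01; rewrite derive1E derive_val.
    by have := hK t; rewrite in_itv /= in t01; move/(_ t01); lra.
  - by apply: derivable_within_continuous => t _.
  - by rewrite in_itv /= lexx ler01.
  - by rewrite in_itv /= lexx ler01.
by rewrite /psi; lra.
Qed.

Variables (n : nat) (f : 'cV[R]_n -> R).
Hypothesis df : differentiable_everywhere f.

Lemma derive_grad x v : 'D_v (f : 'cV[R]_n -> R^o) x = dot (grad f x) v.
Proof.
rewrite deriveE; last exact: df.
have {1}-> : v = \sum_j v j 0 *: delta_mx j 0.
  by rewrite {1}[v]matrix_sum_delta; apply: eq_bigr => j _; rewrite big_ord1.
rewrite linear_sum dotE; apply: eq_bigr => j _.
by rewrite linearZ /= mxE deriveE// mulrC.
Qed.

Lemma is_derive_segment x v (t : R) :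
  is_derive t 1 (fun s : R => f (x + s *: v)) (dot (grad f (x + t *: v)) v).
Proof.
have E : (fun h : R => h^-1 *: (((fun s : R => f (x + s *: v)) \o shift t) (h *: 1)
      - f (x + t *: v))) =
   (fun h : R => h^-1 *: (((f : _ -> R^o) \o shift (x + t *: v)) (h *: v)
      - f (x + t *: v))).
  apply/funext => h /=; congr (_ *: (f _ - _)).
  by rewrite [h *: 1]mulr1 scalerDl addrCA.
apply: DeriveDef; first by rewrite /derivable E; exact: diff_derivable.
by rewrite /derive E -derive_grad.
Qed.

Variable L : R.
Hypothesis L_gt0 : 0 < L.
Hypothesis fL : smooth L f.

Lemma smooth_sqr x y :
  dot (grad f x - grad f y) (grad f x - grad f y) <= L ^+ 2 * dot (x - y) (x - y).
Proof.
rewrite -!l2norm_sqr -exprMn ler_pXn2r// ?nnegrE ?mulr_ge0 ?l2norm_ge0//.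
exact: ltW.
Qed.

(* Young's inequality with weight [L t] replaces Cauchy-Schwarz. *)
Let increment x v (t : R) : 0 < t -> forall s, s ^+ 2 = 1 ->
  s * (dot (grad f (x + t *: v)) v - dot (grad f x) v) <= L * dot v v * t.
Proof.
move=> t0 s s1; set G := grad f (x + t *: v) - grad f x.
have -> : s * (dot (grad f (x + t *: v)) v - dot (grad f x) v) = dot v (s *: G).
  by rewrite dotZr (dotC v G) /G dotDl dotNl.
have Lt : 0 < L * t by rewrite mulr_gt0.
have sG : dot (s *: G) (s *: G) = dot G G.
  by rewrite dotZr dotZl mulrA -expr2 s1 mul1r.
have := dot_amgm v (s *: G) Lt; rewrite sG.
have := smooth_sqr (x + t *: v) x; rewrite -/G addrAC subrr add0r dotZl dotZr.
rewrite -(ler_pM2l (x := (L * t)^-1)) ?invr_gt0//.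
have -> : (L * t)^-1 * (L ^+ 2 * (t * (t * dot v v))) = L * t * dot v v.
  by field; rewrite !gt_eqF.
lra.
Qed.

Lemma smooth_upper x v :
  f (x + v) <= f x + dot (grad f x) v + L / 2 * dot v v.
Proof.
have := @taylor_upper _ _ (L * dot v v) (is_derive_segment x v).
rewrite scale1r scale0r addr0 [L / 2 * _]mulrAC; apply=> t /andP[t0 _].
by have := increment x v t0 (expr1n _ 2); rewrite mul1r.
Qed.

Lemma smooth_lower x v :
  f x + dot (grad f x) v - L / 2 * dot v v <= f (x + v).
Proof.
have H (t : R) : is_derive t 1 (fun s : R => - f (x + s *: v))
    (- dot (grad f (x + t *: v)) v).
  by have := is_derive_segment x v t => ?; exact: is_deriveN.
have := @taylor_upper _ _ (L * dot v v) H.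
rewrite scale1r scale0r addr0 -[L / 2 * _]mulrAC => h.
suff /h : forall t, 0 < t < 1 ->
  - dot (grad f (x + t *: v)) v - - dot (grad f x) v <= L * dot v v * t by lra.
move=> t /andP[t0 _]; have := @increment x v t t0 (-1).
by rewrite sqrrN expr1n => /(_ erefl); lra.
Qed.

(** On the initial part [t] of the segment from [x] to [y], convexity bounds [f] from
    above by the secant, and smoothness bounds it from below by the tangent; dividing
    by [t] compares the slopes up to an error of order [t]. *)
Lemma strongly_convex_lower mu x y : 0 <= mu -> strongly_convex mu f ->
  f x + dot (grad f x) (y - x) + mu / 2 * dot (y - x) (y - x) <= f y.
Proof.
move=> mu0 fmu; set v := y - x; have D0 := dot_ge0 v.
rewrite -lerBrDl; apply/ler_addgt0Pr => e e0.
pose K := (L + mu) / 2 * dot v v.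
have K0 : 0 <= K by rewrite mulr_ge0// divr_ge0// addr_ge0// ltW.
(* The error is [t * K]. *)
pose t := Num.min 1 (e / (K + 1)).
have t0 : 0 < t by rewrite lt_min ltr01 divr_gt0// (lt_le_trans ltr01)// lerDr.
have t1 : t <= 1 by rewrite ge_min lexx.
have tK : t * K <= e.
  apply: le_trans (_ : e / (K + 1) * K <= _).
    by rewrite ler_wpM2r// ge_min lexx orbT.
  rewrite mulrAC ler_pdivrMr ?(lt_le_trans ltr01) ?lerDr//.
  by rewrite ler_wpM2l ?(ltW e0)// lerDl ler01.
have := fmu y x t; rewrite (ltW t0) t1 => /(_ isT).
have -> : t *: y + (1 - t) *: x = x + t *: v.
  by rewrite scalerBl scale1r scalerBr addrCA addrA.
rewrite l2norm_sqr -/v => h1.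
have := smooth_lower x (t *: v); rewrite dotZr dotZr dotZl => h2.
rewrite -(ler_pM2l t0) mulrDr.
have h3 : t * (t * K) <= t * e by rewrite ler_pM2l.
move: h1 h2 h3; rewrite /K; nra.
Qed.

End Smooth.

Section MeanStep.
Context {R : realType} (N d : nat).
Variables (f : 'I_N -> 'cV[R]_d -> R) (L mu : R).
Hypothesis N_gt0 : (0 < N)%N.
Hypothesis mu_gt0 : 0 < mu.
Hypothesis L_gt0 : 0 < L.
Hypothesis df : forall i, differentiable_everywhere (f i).
Hypothesis fL : forall i, smooth L (f i).
Hypothesis fmu : forall i, strongly_convex mu (f i).

Let fbar x := N%:R^-1 * \sum_i f i x.
Let gbar x := average (fun i => grad (f i) x).

Variable xs : 'cV[R]_d.
Hypothesis xs_min : forall x, fbar xs <= fbar x.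

Let Nr_gt0 : 0 < N%:R :> R. Proof. by rewrite ltr0n. Qed.

Let Navg (c : R) : N%:R^-1 * \sum_(i < N) c = c.
Proof. by rewrite sumr_const card_ord -(mulr_natr c) mulrCA mulVf ?mulr1// gt_eqF. Qed.

Let dot_average (u : 'I_N -> 'cV[R]_d) v :
  dot (average u) v = N%:R^-1 * \sum_i dot (u i) v.
Proof. by rewrite dotZl dot_suml. Qed.

Let fbar_upper x v : fbar (x + v) <= fbar x + dot (gbar x) v + L / 2 * dot v v.
Proof.
rewrite /fbar /gbar dot_average -[L / 2 * _]Navg -!mulrDr -!big_split /=.
rewrite ler_wpM2l ?invr_ge0 ?ler0n//; apply: ler_sum => i _.
exact: smooth_upper.
Qed.

(** A gradient step of length [1 / L] from [x] cannot go below the minimum. At the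
    minimizer itself this makes the average gradient vanish. *)
Lemma grad_sqr_le_gap x :
  dot (gbar x) (gbar x) <= 2 * L * (fbar x - fbar xs).
Proof.
have := le_trans (xs_min _) (fbar_upper x (- L^-1 *: gbar x)).
move: (gbar x) => G; rewrite !(dotZr, dotZl) => h.
have {}h : L^-1 / 2 * dot G G <= fbar x - fbar xs.
  have E : L / 2 * (- L^-1 * (- L^-1 * dot G G)) = L^-1 / 2 * dot G G.
    by field; rewrite gt_eqF.
  by move: h; rewrite E; lra.
rewrite -ler_pdivrMl ?mulr_gt0//; apply: le_trans _ h.
by rewrite invfM [2^-1 * _]mulrC.
Qed.

Lemma avg_grad_minimizer : gbar xs = 0.
Proof.
apply: dot_eq0; apply/eqP; rewrite eq_le dot_ge0 andbT.
by apply: le_trans (grad_sqr_le_gap xs) _; rewrite subrr mulr0.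
Qed.

Lemma sum_grad_minimizer : \sum_i grad (f i) xs = 0.
Proof.
have /eqP := avg_grad_minimizer.
by rewrite /gbar /average scaler_eq0 invr_eq0 gt_eqF//= => /eqP.
Qed.

(** The cross terms cancel because the deviations from the average sum to zero. *)
Lemma average_bias_variance (u : 'I_N -> 'cV[R]_d) c :
  N%:R^-1 * \sum_i dot (u i - c) (u i - c) =
  N%:R^-1 * (\sum_i dot (u i - average u) (u i - average u))
  + dot (average u - c) (average u - c).
Proof.
have um : \sum_i u i = N%:R *: average u.
  by rewrite /average scalerA mulfV ?scale1r// gt_eqF.
move: (average u) um => m um.
rewrite -[dot (m - c) (m - c)]Navg -mulrDr -big_split /=; congr (_ * _).
have E i : dot (u i - c) (u i - c) = dot (u i - m) (u i - m) + dot (m - c) (m - c)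
    + 2 * dot (u i - m) (m - c).
  rewrite !(dotDl, dotDr, dotNl, dotNr) (dotC c m) (dotC c (u i)) (dotC m (u i)).
  ring.
under eq_bigr => i _ do rewrite E.
rewrite [LHS]big_split /= -mulr_sumr -dot_suml sumrB um sumr_const card_ord.
by rewrite scaler_nat subrr dot0l mulr0 addr0.
Qed.

Lemma grad_diff_sqr_le (u : 'I_N -> 'cV[R]_d) c :
  N%:R^-1 * \sum_i dot (grad (f i) (u i) - grad (f i) c) (grad (f i) (u i) - grad (f i) c)
  <= L ^+ 2 * (N%:R^-1 * \sum_i dot (u i - c) (u i - c)).
Proof.
rewrite mulrCA ler_wpM2l ?invr_ge0 ?ler0n// mulr_sumr.
by apply: ler_sum => i _; exact: smooth_sqr.
Qed.

(** Each agent's gradient, taken at its own iterate, is an inexact gradient at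
    the mean: the error it causes in the upper model at the mean and in the lower
    model at the minimizer is quadratic in the disagreement, with factor [L]
    rather than [L ^+ 2 / mu]. *)
Lemma mean_step (alpha : R) (u : 'I_N -> 'cV[R]_d) (m G : 'cV[R]_d) :
  0 <= alpha -> 2 * alpha * L <= 1 ->
  m = average u -> G = average (fun i => grad (f i) (u i)) ->
  dot (m - xs - alpha *: G) (m - xs - alpha *: G) <=
  (1 - mu * alpha) * dot (m - xs) (m - xs)
  + (alpha * L + 2 * (alpha * L) ^+ 2)
    * (N%:R^-1 * \sum_i dot (u i - m) (u i - m)).
Proof.
move=> a0 aL mE GE.
set C := N%:R^-1 * _; set X := dot (m - xs) (m - xs).
have C0 : 0 <= C.
  by rewrite mulr_ge0 ?invr_ge0 ?ler0n ?sumr_ge0// => i _; exact: dot_ge0.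
have inner : fbar m - fbar xs - L / 2 * C + mu / 2 * (C + X) <= dot G (m - xs).
  rewrite /C /X mE -average_bias_variance -mE GE dot_average /fbar.
  rewrite !(mulrCA _ (N%:R^-1)) -!mulrBr -mulrDr ler_wpM2l ?invr_ge0 ?ler0n//.
  rewrite !mulr_sumr -!sumrB -big_split /=; apply: ler_sum => i _.
  have := smooth_upper (@df i) L_gt0 (@fL i) (u i) (m - u i); rewrite [u i + _]addrC subrK.
  have := strongly_convex_lower (@df i) L_gt0 (@fL i) (u i) xs (ltW mu_gt0) (@fmu i).
  rewrite !(dotDl, dotDr, dotNl, dotNr) !opprK.
  rewrite (dotC xs (u i)) (dotC m (u i)) => h1 h2; lra.
have Gsq : dot G G <= 4 * L * (fbar m - fbar xs) + 2 * L ^+ 2 * C.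
  have -> : G = gbar m + average (fun i => grad (f i) (u i) - grad (f i) m).
    by rewrite GE /gbar /average -scalerDr -big_split /=; congr (_ *: _);
       apply: eq_bigr => i _; rewrite addrC subrK.
  apply: le_trans (dot_two _ _) _.
  have h1 := grad_sqr_le_gap m.
  have h2 := dot_average_le (fun i => grad (f i) (u i) - grad (f i) m) N_gt0.
  have h3 := grad_diff_sqr_le u m; rewrite -/C in h3.
  lra.
have gap := xs_min m.
rewrite !(dotDl (m - xs), dotDr _ (m - xs), dotNl, dotNr, dotZl, dotZr).
rewrite (dotC (m - xs) G) -/X.
have h1 : 0 <= 2 * alpha * (dot G (m - xs) - (fbar m - fbar xs - L / 2 * C + mu / 2 * (C + X))).
  by rewrite mulr_ge0// ?mulr_ge0// subr_ge0.
have h2 : 0 <= alpha ^+ 2 * (4 * L * (fbar m - fbar xs) + 2 * L ^+ 2 * C - dot G G).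
  by rewrite mulr_ge0 ?sqr_ge0// subr_ge0.
have h3 : 0 <= 2 * alpha * (1 - 2 * alpha * L) * (fbar m - fbar xs).
  by rewrite mulr_ge0 ?subr_ge0// mulr_ge0 ?subr_ge0// mulr_ge0.
have h4 : 0 <= alpha * mu * C.
  by rewrite mulr_ge0// mulr_ge0// ltW.
nra.
Qed.

End MeanStep.

(** * One noiseless step in the weighted norms *)

Section Lyapunov.
Context {R : realType} (N d : nat).
Variables (W : nat -> 'M[R]_N) (tau : nat) (lambda : R).
Hypothesis hW : network_assumption W tau lambda.

Local Notation Wk k := (kron d (W k)).
Local Notation Wt k := (kron d (W k - avg_mx N)).
Local Notation Rk := (Rmx d W tau lambda).
Local Notation dlt := (delta tau lambda).
Local Notation eta := (eta tau lambda).
Local Notation Q := (Qcst tau lambda).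
Local Notation sqn q := (dot q q).

Lemma delta_le1 : dlt <= 1.
Proof.
rewrite ler_pdivrMr ?(tau_gt0 hW)// mul1r.
have [_ t1 _ _] := hW.
by apply: (@le_trans _ _ 1); [rewrite gerBl sqr_ge0|rewrite ler1n].
Qed.

Lemma eta_gt0 : 0 < eta.
Proof.
have /andP[_ l1] := lambda_bounds hW.
by rewrite divr_gt0 ?mulr_gt0 ?(tau_gt0 hW)// subr_gt0.
Qed.

Lemma eta_le_delta : eta <= dlt / 2.
Proof.
have /andP[l0 l1] := lambda_bounds hW; have t0 := tau_gt0 hW.
rewrite /Defs.eta /delta invfM mulrCA mulrC ler_pM2r ?invr_gt0//.
rewrite ler_pM2r ?invr_gt0//; nra.
Qed.

Lemma mixing_defect_bound k q :
  sqn (kron d (1%:M - W k) *m q) <= 4 * sqn q.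
Proof.
rewrite -kronB kron1 mulmxBl mul1mx.
apply: le_trans (dot_two _ _) _; rewrite dotNl dotNr opprK.
have : sqn (Wk k *m q) <= 1 * sqn q.
  apply: kron_bound => v; rewrite mul1r; exact/ds_nonexpansive/(ds_W hW).
by lra.
Qed.

Let r'_le k q : qform (Rk k.+1) (Wt k *m q) <= sqn q.
Proof. exact: le_trans (Rmx_le hW _ _) (Wt_nonexpansive hW _ _). Qed.

Let one_plus : 1 + (dlt / 2)^-1 <= 3 / dlt.
Proof.
have d0 := delta_gt0 hW.
by rewrite invf_div ler_pdivlMr// mulrDl mul1r divfK ?gt_eqF//; have := delta_le1; lra.
Qed.

(* The Lyapunov equation leaves [- delta |v|^2]; Young's inequality with weight
   [delta / 2] spends half of it. *)
Let contract k v w :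
  qform (Rk k.+1) (Wt k *m v + w) <=
  qform (Rk k) v - dlt / 2 * sqn v + 3 / dlt * qform (Rk k.+1) w.
Proof.
have d0 := delta_gt0 hW.
have d20 : 0 < dlt / 2 by lra.
have := bil_young (Wt k *m v) w (Rmx_sym d hW k.+1) (Rmx_ge0 hW k.+1) d20.
move=> /le_trans; apply.
rewrite (Rmx_lyapunov hW).
have h1 := ler_wpM2r (Rmx_ge0 hW k.+1 w) one_plus.
have h2 := Rmx_le hW k v; have h3 := dot_ge0 v.
have h4 : dlt / 2 * qform (Rk k) v <= dlt / 2 * sqn v by rewrite ler_pM2l.
have h5 : 0 <= dlt / 2 * (dlt * sqn v).
  by rewrite mulr_ge0 ?(ltW d20)// mulr_ge0// ltW.
rewrite mulrDl; lra.
Qed.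

(** The disagreement and the tracking error feed one another through [eta * z] only.
    Since [eta <= delta / 2], Young's inequality charges at most
    [15 / 16 * delta * |z|^2] for it, which the decrease [delta * |z|^2] of the
    doubled weighted norm of [z] pays: this is the reason for scaling the tracking
    error by [alpha / eta] and for the weight 2. *)
Lemma lyapunov_step (alpha : R) k x z b :
  0 <= alpha ->
  qform (Rk k.+1) (Wt k *m (x - eta *: z - alpha *: b))
  + 2 * qform (Rk k.+1) (Wt k *m z - (alpha / eta) *: (kron d (1%:M - W k) *m b))
  <= qform (Rk k) x + 2 * qform (Rk k) z
     - dlt / 2 * sqn x - dlt / 16 * sqn z
     + alpha ^+ 2 / dlt * (15 + 24 / eta ^+ 2) * sqn b.
Proof.
move=> a0; have d0 := delta_gt0 hW; have e0 := eta_gt0; have ed := eta_le_delta.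
have hx := contract k x (Wt k *m (- eta *: z - alpha *: b)).
have hz := contract k z (- (alpha / eta) *: (kron d (1%:M - W k) *m b)).
rewrite -mulmxDr addrA scaleNr in hx; rewrite scaleNr in hz.
have wx : 3 / dlt * qform (Rk k.+1) (Wt k *m (- (eta *: z) - alpha *: b)) <=
    15 / 16 * dlt * sqn z + alpha ^+ 2 / dlt * 15 * sqn b.
  have y : sqn (- (eta *: z) - alpha *: b) <=
      5 / 4 * (eta ^+ 2 * sqn z) + 5 * (alpha ^+ 2 * sqn b).
    have q0 : 0 < 4^-1 :> R by [].
    apply: le_trans (dot_young _ _ q0) _.
    by rewrite !(dotNl, dotNr, dotZl, dotZr) !opprK invrK; lra.
  have y1 : eta ^+ 2 * sqn z <= dlt ^+ 2 / 4 * sqn z.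
    by rewrite ler_wpM2r ?dot_ge0//; nra.
  have y2 : qform (Rk k.+1) (Wt k *m (- (eta *: z) - alpha *: b)) <=
      5 / 16 * (dlt ^+ 2 * sqn z) + 5 * (alpha ^+ 2 * sqn b).
    by apply: le_trans (r'_le _ _) (le_trans y _); lra.
  have y3 : 0 <= 3 / dlt by rewrite divr_ge0// ltW.
  apply: le_trans (ler_wpM2l y3 y2) _; rewrite le_eqVlt; apply/orP; left.
  by apply/eqP; field; rewrite gt_eqF.
have wz : 3 / dlt * qform (Rk k.+1) (- ((alpha / eta) *: (kron d (1%:M - W k) *m b)))
    <= alpha ^+ 2 / dlt * (12 / eta ^+ 2) * sqn b.
  have y3 : 0 <= 3 / dlt by rewrite divr_ge0// ltW.
  have y2 : qform (Rk k.+1) (- ((alpha / eta) *: (kron d (1%:M - W k) *m b))) <=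
      (alpha / eta) ^+ 2 * (4 * sqn b).
    apply: le_trans (Rmx_le hW _ _) _.
    rewrite dotNl dotNr opprK dotZl dotZr mulrA -expr2.
    by rewrite ler_wpM2l ?sqr_ge0// mixing_defect_bound.
  apply: le_trans (ler_wpM2l y3 y2) _; rewrite le_eqVlt; apply/orP; left.
  by apply/eqP; field; rewrite !gt_eqF.
have -> : alpha ^+ 2 / dlt * (15 + 24 / eta ^+ 2) * sqn b =
  alpha ^+ 2 / dlt * 15 * sqn b + 2 * (alpha ^+ 2 / dlt * (12 / eta ^+ 2) * sqn b).
  by ring.
lra.
Qed.

(** With [R <= I], [|Wt| <= 1] and [|I - W| <= 2], the two terms add up to exactly
    [Q = 1 + 8 / eta ^+ 2]. *)
Lemma noise_step (alpha : R) k s :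
  qform (Rk k.+1) (Wt k *m (alpha *: s))
  + 2 * qform (Rk k.+1) ((alpha / eta) *: (kron d (1%:M - W k) *m s))
  <= alpha ^+ 2 * Q * sqn s.
Proof.
have e0 := eta_gt0.
have h1 := r'_le k (alpha *: s); rewrite dotZl dotZr mulrA -expr2 in h1.
have h2 := Rmx_le hW k.+1 ((alpha / eta) *: (kron d (1%:M - W k) *m s)).
rewrite dotZl dotZr mulrA -expr2 in h2.
have h3 : (alpha / eta) ^+ 2 * sqn (kron d (1%:M - W k) *m s) <=
   (alpha / eta) ^+ 2 * (4 * sqn s).
  by rewrite ler_wpM2l ?sqr_ge0// mixing_defect_bound.
have -> : alpha ^+ 2 * Q * sqn s =
    alpha ^+ 2 * sqn s + 2 * ((alpha / eta) ^+ 2 * (4 * sqn s)).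
  by rewrite /Qcst; field; rewrite gt_eqF.
lra.
Qed.

Section Stepsize.
Variables (L mu alpha : R).
Hypothesis hmu : 0 < mu <= L.
Hypothesis halpha : 0 < alpha <= alpha_bar L mu tau lambda.

Lemma Qcst_ge : 33 <= Q.
Proof.
have d1 := delta_le1; have e0 := eta_gt0; have ed := eta_le_delta.
rewrite /Qcst -lerBlDl ler_pdivlMr ?exprn_gt0//; nra.
Qed.

Lemma stepsize_sqr : 320 * alpha ^+ 2 * L ^+ 3 * Q <= mu * dlt ^+ 2.
Proof.
have /andP[mu0 muL] := hmu; have L0 : 0 < L by exact: lt_le_trans muL.
have /andP[a0] := halpha; have Q33 := Qcst_ge; have d0 := delta_gt0 hW.
have Q0 : 0 < Q by lra.
have k0 : 0 < Q * (L / mu) by rewrite mulr_gt0// divr_gt0.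
have S0 : 0 < Num.sqrt (320 : R) by rewrite sqrtr_gt0 ltr0n.
have S2 : Num.sqrt (320 : R) ^+ 2 = 320 by rewrite sqr_sqrtr ?ler0n.
rewrite /alpha_bar; move: (Num.sqrt 320) S0 S2 => S S0 S2.
have T0 : 0 < Num.sqrt (Q * (L / mu)) by rewrite sqrtr_gt0.
rewrite ler_pdivlMr; last by rewrite mulr_gt0// mulr_gt0.
move=> h.
have : (alpha * (S * L * Num.sqrt (Q * (L / mu)))) ^+ 2 <= dlt ^+ 2.
  rewrite ler_pXn2r// nnegrE ?(ltW d0)// mulr_ge0 ?(ltW a0)//.
  by rewrite mulr_ge0 ?(ltW T0)// mulr_ge0// ltW.
rewrite !exprMn S2 sqr_sqrtr ?(ltW k0)// -(ler_pM2l mu0).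
apply: le_trans; rewrite le_eqVlt; apply/orP; left; apply/eqP.
by field; rewrite gt_eqF.
Qed.

Lemma stepsize_le : 16 * alpha * L <= dlt.
Proof.
have /andP[mu0 muL] := hmu; have L0 : 0 < L by exact: lt_le_trans muL.
have /andP[a0 _] := halpha; have Q33 := Qcst_ge; have d0 := delta_gt0 hW.
rewrite -(@ler_pXn2r _ 2)// ?nnegrE ?(ltW d0)//; last first.
  by rewrite !mulr_ge0// ltW.
rewrite -(ler_pM2l L0); apply: (@le_trans _ _ (mu * dlt ^+ 2)); last first.
  by rewrite ler_wpM2r ?sqr_ge0.
apply: le_trans stepsize_sqr.
have -> : L * (16 * alpha * L) ^+ 2 = 256 * (alpha ^+ 2 * L ^+ 3) by ring.
have -> : 320 * alpha ^+ 2 * L ^+ 3 * Q = 320 * (Q * (alpha ^+ 2 * L ^+ 3)) by ring.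
have A0 : 0 <= alpha ^+ 2 * L ^+ 3 by rewrite mulr_ge0 ?exprn_ge0// ltW.
by have := ler_wpM2r A0 Q33; lra.
Qed.

(** Collecting coefficients: the gradient error, amplified by [Q / delta], costs at
    most [mu * alpha / 2 * (C + X)] by [stepsize_sqr], half of the descent of [X]; this
    is where the condition number enters the stepsize. All other terms in [C] and [Z] are absorbed by
    the decrease of the weighted norms because [16 * alpha * L <= delta]. *)
Lemma combine_steps (X X' C Z B ex ez ex' ez' : R) :
  0 <= X -> 0 <= C -> 0 <= Z -> ex <= C -> ez <= Z ->
  X' <= (1 - mu * alpha) * X + (alpha * L + 2 * (alpha * L) ^+ 2) * C ->
  B <= L ^+ 2 * (C + X) ->
  ex' + 2 * ez' <= ex + 2 * ez - dlt / 2 * C - dlt / 16 * Z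
     + alpha ^+ 2 / dlt * (15 + 24 / eta ^+ 2) * B ->
  X' + 16 * alpha * L / dlt * (ex' + 2 * ez') <=
  (1 - mu * alpha / 2) * (X + 16 * alpha * L / dlt * (ex + 2 * ez)).
Proof.
move=> X0 C0 Z0 exC ezZ hX' hB hE.
have /andP[mu0 muL] := hmu; have L0 : 0 < L by exact: lt_le_trans muL.
have /andP[a0 _] := halpha; have d0 := delta_gt0 hW; have d1 := delta_le1.
have e0 := eta_gt0; have ed := eta_le_delta.
set omega := 16 * alpha * L / dlt.
set c := 15 + 24 / eta ^+ 2.
have w0 : 0 < omega by rewrite divr_gt0// mulr_gt0// mulr_gt0.
have wd : omega * dlt = 16 * (alpha * L) by rewrite /omega; field; rewrite gt_eqF.
have w1 : omega <= 1 by rewrite ler_pdivrMr// mul1r stepsize_le.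
have aL0 : 0 < alpha * L by rewrite mulr_gt0.
have c0 : 0 <= c by rewrite addr_ge0// divr_ge0// sqr_ge0.
have cQ : c <= 10 * Q.
  have : 1 <= eta ^- 2 by rewrite invf_ge1 ?exprn_gt0//; nra.
  by rewrite /c /Qcst; lra.
(* [320 = 2 * 16 * 10]: the halving of [mu * alpha], the factor of [omega], and [cQ]. *)
have gB : omega * (alpha ^+ 2 / dlt * c * B) <= mu * alpha / 2 * (C + X).
  apply: (@le_trans _ _ (omega * (alpha ^+ 2 / dlt * (10 * Q) * (L ^+ 2 * (C + X))))).
    rewrite ler_pM2l//.
    have k0 : 0 <= alpha ^+ 2 / dlt by rewrite divr_ge0 ?sqr_ge0// ltW.
    apply: (@le_trans _ _ (alpha ^+ 2 / dlt * c * (L ^+ 2 * (C + X)))).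
      by rewrite ler_wpM2l// mulr_ge0.
    rewrite ler_wpM2r ?ler_wpM2l//.
    by rewrite mulr_ge0 ?sqr_ge0 ?addr_ge0.
  have -> : omega * (alpha ^+ 2 / dlt * (10 * Q) * (L ^+ 2 * (C + X))) =
      320 * alpha ^+ 2 * L ^+ 3 * Q / dlt ^+ 2 * (alpha / 2) * (C + X).
    by rewrite /omega; field; rewrite gt_eqF.
  rewrite ler_wpM2r ?addr_ge0// -(mulrA mu) ler_wpM2r ?divr_ge0 ?(ltW a0)//.
  by rewrite ler_pdivrMr ?exprn_gt0// stepsize_sqr.
rewrite -/c in hE; clearbody omega c.
have hE' := ler_wpM2l (ltW w0) hE.
have muaL : mu * alpha <= alpha * L by rewrite mulrC ler_pM2l.
have aLd : 16 * (alpha * L) <= dlt by rewrite mulrA stepsize_le.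
have h1 : omega * (mu * alpha / 2 * (ex + 2 * ez)) <= alpha * L / 2 * (C + 2 * Z).
  apply: (@le_trans _ _ (omega * (mu * alpha / 2 * (C + 2 * Z)))).
    by rewrite ler_pM2l// ler_pM2l ?divr_gt0 ?mulr_gt0//; lra.
  apply: (@le_trans _ _ (1 * (mu * alpha / 2 * (C + 2 * Z)))).
    rewrite ler_wpM2r// mulr_ge0 ?addr_ge0 ?mulr_ge0 ?invr_ge0 ?ler0n//; exact: ltW.
  by rewrite mul1r ler_wpM2r ?addr_ge0 ?mulr_ge0//; lra.
have h2 : (alpha * L) ^+ 2 * C <= alpha * L / 16 * C.
  by rewrite ler_wpM2r// expr2 ler_wpM2l ?(ltW aL0)//; lra.
have h3 : mu * alpha / 2 * C <= alpha * L / 2 * C by rewrite ler_wpM2r//; lra.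
have h4 : 0 <= alpha * L * C by rewrite mulr_ge0// ltW.
have h5 : 0 <= alpha * L * Z by rewrite mulr_ge0// ltW.
have h6 : omega * (dlt / 2 * C) = 8 * (alpha * L * C).
  have -> : omega * (dlt / 2 * C) = omega * dlt / 2 * C by ring.
  by rewrite wd; field.
have h7 : omega * (dlt / 16 * Z) = alpha * L * Z.
  have -> : omega * (dlt / 16 * Z) = omega * dlt / 16 * Z by ring.
  by rewrite wd; field.
have hE2 : omega * (ex' + 2 * ez') <= omega * (ex + 2 * ez)
    - omega * (dlt / 2 * C) - omega * (dlt / 16 * Z)
    + omega * (alpha ^+ 2 / dlt * c * B).
  by apply: le_trans hE' _; rewrite -!mulrBr -mulrDr.
rewrite h6 h7 in hE2.
lra.
Qed.

End Stepsize.

End Lyapunov.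

(** * Expectations and orthogonality to a sigma-algebra *)

Section Probability.
Context {R : realType} {dO : measure_display} {Omega : measurableType dO}.
Variable P : probability Omega R.
Implicit Types X Y u v : Omega -> R.

Local Notation integ X := (P.-integrable setT (EFin \o X)).
Local Notation Ex X := (Rintegral P setT X).

Lemma integ_meas X : integ X -> measurable_fun setT X.
Proof. by move=> /(measurable_int P)/measurable_EFinP. Qed.

Lemma integ_le X Y : measurable_fun setT X -> (forall w, `|X w| <= Y w) ->
  integ Y -> integ X.
Proof.
move=> mX XY iY; apply: (le_integrable _ _ _ iY) => //; first exact/measurable_EFinP.
by move=> w _; rewrite /= lee_fin (le_trans (XY w))// ler_norm.
Qed.

Lemma integD X Y : integ X -> integ Y -> integ (fun w => X w + Y w).
Proof.
move=> iX iY; have := integrableD measurableT iX iY.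
by apply: eq_integrable => // w _; rewrite /= EFinD.
Qed.

Lemma integZ c X : integ X -> integ (fun w => c * X w).
Proof.
move=> iX; have := integrableZl measurableT c iX.
by apply: eq_integrable => // w _; rewrite /= EFinM.
Qed.

Lemma integN X : integ X -> integ (fun w => - X w).
Proof.
move=> /(integZ (-1)); apply: eq_integrable => // w _.
by rewrite /= mulN1r.
Qed.

Lemma integB X Y : integ X -> integ Y -> integ (fun w => X w - Y w).
Proof. by move=> iX iY; apply: integD => //; exact: integN. Qed.

Lemma integ_cst c : integ (fun=> c).
Proof. exact: finite_measure_integrable_cst. Qed.

Lemma integ_sum (I : finType) (X : I -> Omega -> R) :
  (forall i, integ (X i)) -> integ (fun w => \sum_i X i w).
Proof.
move=> iX; have := @integrable_sum _ _ _ P setT measurableT _ (index_enum I) xpredT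
  (fun i => EFin \o X i) (fun i _ => iX i).
by apply: eq_integrable => // w _; rewrite /= -sumEFin.
Qed.

Lemma integ_indic X A : measurable A -> integ X -> integ (fun w => X w * \1_A w).
Proof.
move=> mA iX; apply: (@integ_le _ (fun w => `|X w|)).
- by apply: measurable_funM => //; exact: integ_meas.
- by move=> w; rewrite normrM ler_piMr// indicE; case: (_ \in _); rewrite ?normr1 ?normr0.
- have := integrable_abse iX; exact: eq_integrable.
Qed.

Lemma ExE X : integ X -> (\int[P]_w (X w)%:E)%E = (Ex X)%:E.
Proof. by move=> iX; rewrite fineK// integrable_fin_num. Qed.

Lemma ExD X Y : integ X -> integ Y -> Ex (fun w => X w + Y w) = Ex X + Ex Y.
Proof. by move=> iX iY; rewrite RintegralD. Qed.

Lemma ExZ c X : integ X -> Ex (fun w => c * X w) = c * Ex X.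
Proof. by move=> iX; rewrite RintegralZl. Qed.

Lemma Ex_sum (I : finType) (X : I -> Omega -> R) :
  (forall i, integ (X i)) -> Ex (fun w => \sum_i X i w) = \sum_i Ex (X i).
Proof.
move=> iX; apply: EFin_inj; rewrite -ExE; last exact: integ_sum.
rewrite -sumEFin; under [RHS]eq_bigr => i _ do rewrite -ExE//.
rewrite -integral_sum//.
by apply: eq_integral => w _; rewrite -sumEFin.
Qed.

Lemma Ex_le X Y : integ X -> integ Y -> (forall w, X w <= Y w) -> Ex X <= Ex Y.
Proof. by move=> iX iY XY; apply: le_Rintegral. Qed.

Lemma Ex_cst c : Ex (fun=> c) = c.
Proof.
rewrite /Rintegral integral_cst//.
have -> : (P : {measure set Omega -> \bar R}) setT = 1%E by exact: probability_setT.
by rewrite mule1.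
Qed.

Lemma integral_indicE X A : measurable A ->
  (\int[P]_(w in A) (X w)%:E = \int[P]_w (X w * \1_A w)%:E)%E.
Proof.
move=> mA; rewrite integral_mkcond; apply: eq_integral => w _.
by rewrite patchE indicE; case: ifPn => _; rewrite ?mulr1 ?mulr0.
Qed.

Definition sqint X := measurable_fun setT X /\ integ (fun w => X w ^+ 2).

Lemma sqint_mul X Y : sqint X -> sqint Y -> integ (fun w => X w * Y w).
Proof.
move=> [mX iX] [mY iY]; apply: (@integ_le _ (fun w => X w ^+ 2 + Y w ^+ 2)).
- exact: measurable_funM.
- move=> w; have := sqr_ge0 (`|X w| - `|Y w|); rewrite sqrrB !real_normK ?num_real//.
  rewrite normrM; have := mulr_ge0 (normr_ge0 (X w)) (normr_ge0 (Y w)); lra.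
- exact: integD.
Qed.

Lemma sqint_le X Y : measurable_fun setT X -> (forall w, X w ^+ 2 <= Y w) ->
  integ Y -> sqint X.
Proof.
move=> mX XY iY; split=> //; apply: integ_le iY.
- exact: measurable_funX.
- by move=> w; rewrite ger0_norm ?sqr_ge0.
Qed.

Lemma sqintD X Y : sqint X -> sqint Y -> sqint (fun w => X w + Y w).
Proof.
move=> [mX iX] [mY iY].
apply: (@sqint_le _ (fun w => 2 * X w ^+ 2 + 2 * Y w ^+ 2)).
- exact: measurable_funD.
- by move=> w; have := sqr_ge0 (X w - Y w); nra.
- by apply: integD; exact: integZ.
Qed.

Lemma sqintZ c X : sqint X -> sqint (fun w => c * X w).
Proof.
move=> [mX iX]; apply: (@sqint_le _ (fun w => c ^+ 2 * X w ^+ 2)).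
- exact: measurable_funM.
- by move=> w; rewrite exprMn.
- exact: integZ.
Qed.

Lemma sqint_cst c : sqint (fun=> c).
Proof. by split; [exact: measurable_cst|exact: integ_cst]. Qed.

Section SubSigma.
Variable C : set (set Omega).
Hypothesis mC : C `<=` measurable.

Local Notation T := (g_sigma_algebraType C).

Lemma gen_measurable : <<s C >> `<=` measurable.
Proof. by apply: smallest_sub => //; exact: sigma_algebra_measurable. Qed.

Lemma gen_measurable_fun d' (S : measurableType d') (f : Omega -> S) :
  measurable_fun [set: T] f -> measurable_fun [set: Omega] f.
Proof. by move=> mf _ B mB; apply: gen_measurable; exact: mf. Qed.

(** The measurable sets on which the integral vanishes form a Dynkin system. *)
Lemma zero_on_generated X : setI_closed C -> C setT -> integ X ->
  (forall A, C A -> (\int[P]_(w in A) (X w)%:E = 0)%E) ->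
  forall A, <<s C >> A -> (\int[P]_(w in A) (X w)%:E = 0)%E.
Proof.
move=> CI CT iX X0 A; rewrite -setI_closed_g_dynkin_g_sigma_algebra//.
have iA B : measurable B -> P.-integrable B (EFin \o X).
  by move=> mB; apply: integrableS iX.
suff : <<d C >> `<=` [set B | measurable B /\ (\int[P]_(w in B) (X w)%:E = 0)%E].
  by move=> /(_ A) /[apply] -[].
apply: smallest_sub; last by move=> B CB; split; [exact: mC|exact: X0].
split; first by split; [exact: measurableT|exact: X0].
- move=> B [mB B0]; split; first exact: measurableC.
  have : (\int[P]_(w in B `|` ~` B) (X w)%:E = 0)%E by rewrite setUv X0.
  rewrite integral_setU_EFin//.
  + by rewrite B0 add0e.
  + exact: measurableC.
  + by rewrite setUv; exact: integ_meas.
  + by apply/disj_setPS => w [].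
- move=> F tF HF; have mF k : measurable (F k) by case: (HF k).
  split; first exact: bigcupT_measurable.
  rewrite integral_bigcup//; last by apply: iA; exact: bigcupT_measurable.
  by apply: eseries0 => k _ _; case: (HF k).
Qed.

Import HBNNSimple.

Let generated_orthogonal_ge0 X v : integ X ->
  (forall A, <<s C >> A -> (\int[P]_(w in A) (X w)%:E = 0)%E) ->
  measurable_fun [set: T] v -> (forall w, 0 <= v w) ->
  integ (fun w => X w * v w) -> Ex (fun w => X w * v w) = 0.
Proof.
move=> iX X0 mv v0 iXv.
have mX := integ_meas iX.
pose f : T -> \bar R := EFin \o v.
have mf : measurable_fun [set: T] f by exact/measurable_EFinP.
have f0 w : [set: T] w -> (0 <= f w)%E by rewrite lee_fin.
pose a := nnsfun_approx measurableT mf.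
have ma k : measurable_fun [set: Omega] (a k : Omega -> R).
  by apply: gen_measurable_fun; exact: measurable_funPT.
have Ek k : (\int[P]_w (X w * a k w)%:E = 0)%E.
  pose s := fset_set (a k @` setT).
  have aE w : a k w = \sum_(i < #|`s|%fset) (s`_i * \1_(a k @^-1` [set s`_i]) w).
    exact: fimfunEord.
  have mA i : <<s C >> (a k @^-1` [set s`_i] : set Omega).
    by have := measurable_funPTI (a k) (measurable_set1 s`_i).
  have iA i : integ (fun w => s`_i * (X w * \1_(a k @^-1` [set s`_i]) w)).
    by apply/integZ/integ_indic => //; exact: gen_measurable.
  have -> : (\int[P]_w (X w * a k w)%:E)%E = (Ex (fun w =>
     \sum_(i < #|`s|%fset) s`_i * (X w * \1_(a k @^-1` [set s`_i]) w)))%:E.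
    rewrite -ExE; last exact: integ_sum.
    apply: eq_integral => w _; congr EFin; rewrite [in LHS]aE mulr_sumr.
    by apply: eq_bigr => i _; rewrite mulrCA.
  rewrite Ex_sum// big1// => i _; rewrite ExZ; last first.
    by apply: integ_indic => //; exact: gen_measurable.
  by rewrite /Rintegral -integral_indicE ?X0 ?mulr0//; exact: gen_measurable.
have [] := @dominated_convergence _ _ _ P setT measurableT
   (fun k w => (X w * a k w)%:E) (EFin \o (fun w => X w * v w))
   (fun w => `|(X w * v w)%:E|%E).
- move=> k; apply/measurable_EFinP; exact: measurable_funM.
- exact: measurable_int iXv.
- apply: aeW => w _; rewrite /= EFinM.
  under eq_cvg do rewrite EFinM.
  have := cvg_nnsfun_approx measurableT mf f0 (I : [set: T] w).
  by move=> /(cvgeZl (y := (X w)%:E)); exact.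
- exact: integrable_abse iXv.
- apply: aeW => w k _; rewrite !abse_EFin lee_fin !normrM ler_wpM2l//.
  rewrite !ger0_norm//; have := le_approx k f0 (I : [set: T] w).
  by rewrite lee_fin /a nnsfun_approxE.
move=> _ _; under eq_fun do rewrite Ek.
by move/(cvg_lim (@ereal_hausdorff R)); rewrite lim_cst// ExE// => -[].
Qed.

(** For [v >= 0] this is a limit of simple functions, whose level sets belong to the
    generated sigma-algebra; the general case splits [v] by sign. *)
Lemma generated_orthogonal X v : integ X ->
  (forall A, <<s C >> A -> (\int[P]_(w in A) (X w)%:E = 0)%E) ->
  measurable_fun [set: T] v ->
  integ (fun w => X w * v w) -> Ex (fun w => X w * v w) = 0.
Proof.
move=> iX X0 mv iXv; have mX := integ_meas iX.
have mv' := gen_measurable_fun mv.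
have bound (s : Omega -> R) : measurable_fun [set: Omega] s ->
    (forall w, `|s w| <= `|v w|) -> integ (fun w => X w * s w).
  move=> ms sv; apply: (@integ_le _ (fun w => `|X w * v w|)).
  - exact: measurable_funM.
  - by move=> w; rewrite !normrM ler_wpM2l.
  - by have := integrable_abse iXv; exact: eq_integrable.
have mp : measurable_fun [set: T] (fun w => Num.max (v w) 0).
  by apply: measurable_maxr.
have mn : measurable_fun [set: T] (fun w => Num.max (- v w) 0).
  by apply: measurable_maxr => //; exact: measurableT_comp.
have ip : integ (fun w => X w * Num.max (v w) 0).
  apply: bound; first exact: gen_measurable_fun.
  by move=> w; rewrite ger0_norm ?le_max ?lexx ?orbT// ge_max ler_norm normr_ge0.
have im : integ (fun w => X w * Num.max (- v w) 0).
  apply: bound; first exact: gen_measurable_fun.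
  move=> w; rewrite ger0_norm ?le_max ?lexx ?orbT// ge_max normr_ge0 andbT.
  by rewrite -normrN ler_norm.
have -> : (fun w => X w * v w) =
    (fun w => X w * Num.max (v w) 0 + (-1) * (X w * Num.max (- v w) 0)).
  apply/funext => w; have [v0|v0] := leP (v w) 0.
    by rewrite max_l ?oppr_ge0//; ring.
  by rewrite max_r ?oppr_le0 ?ltW//; ring.
rewrite ExD//; last exact: integZ.
rewrite ExZ// !generated_orthogonal_ge0 ?mulr0 ?addr0// => w; by rewrite le_max lexx orbT.
Qed.

End SubSigma.

End Probability.

(** * Measurability of gradients and conditional independence *)

Section ContinuousMeasurable.
Context {R : realType}.

(** Open sets are countable unions of rational boxes, so a continuous function
    of a vector with measurable coordinates is measurable. *)
Lemma continuous_coord_measurable d (T : measurableType d) n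
    (X : T -> 'cV[R]_n) (h : 'cV[R]_n -> R) :
  (forall j, measurable_fun setT (fun w => X w j 0)) -> continuous h ->
  measurable_fun setT (fun w => h (X w)).
Proof.
move=> mX ch.
have openX (U : set 'cV[R]_n) : open U -> measurable (X @^-1` U).
  move=> oU.
  pose box (i : 'cV[rat]_n * rat) : set 'cV[R]_n :=
    [set v | forall j, `|v j 0 - ratr (i.1 j 0)| < ratr i.2].
  have -> : X @^-1` U = \bigcup_(i : 'cV[rat]_n * rat)
      (if `[< box i `<=` U >] then X @^-1` box i else set0).
    apply/seteqP; split=> [w /= Uw|w [i _]]; last first.
      by case: asboolP => // bU; exact: bU.
    have /nbhs_ballP[e /= e0 eU] := open_nbhs_nbhs (conj oU Uw).
    have [r] : exists r : rat, ratr r \in `]0, (e / 2)[.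
      by apply: rat_in_itvoo; rewrite divr_gt0.
    rewrite in_itv /= => /andP[r0 re].
    have H (j : 'I_n) : exists q : rat, `|X w j 0 - ratr q| < ratr r.
      have [|q] := @rat_in_itvoo _ (X w j 0 - ratr r) (X w j 0 + ratr r).
        by rewrite ltrBlDr -addrA ltrDl addr_gt0.
      rewrite in_itv /= => /andP[q1 q2]; exists q.
      by rewrite ltr_norml; apply/andP; split; lra.
    have /choice[q qP] := H.
    exists (\col_j q j, r) => //.
    have bw : box (\col_j q j, r) (X w) by move=> j; rewrite /= mxE.
    case: asboolP => // -[] u bu; apply: eU; split=> // j l.
    rewrite ord1 /ball /=.
    have h1 := bw j; have h2 := bu j; rewrite /= mxE in h1 h2.
    have -> : X w j 0 - u j 0 = (X w j 0 - ratr (q j)) - (u j 0 - ratr (q j)) by ring.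
    by apply: le_lt_trans (ler_normB _ _) _; lra.
  apply: countable_bigcupT_measurable; first exact: countableP.
  move=> i; case: asboolP => // _.
  have -> : X @^-1` box i =
     \bigcap_(j in [set: 'I_n]) [set w | `|X w j 0 - ratr (i.1 j 0)| < ratr i.2].
    by apply/seteqP; split=> [w bw j _|w bw j]; [exact: bw|exact: bw].
  apply: fin_bigcap_measurable => // j _.
  have m1 : measurable_fun setT (fun w => `|X w j 0 - ratr (i.1 j 0)|).
    apply: measurableT_comp => //; exact: measurable_funB.
  have := measurable_fun_ltr m1 (measurable_cst (ratr i.2 : R)).
  by move=> /(_ measurableT [set true] I); rewrite setTI.
apply: (measurability _ (RGenInftyO.measurableE R)) => _ [_ [a ->] <-].
rewrite setTI; apply: (openX (h @^-1` `]-oo, a[)).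
by apply: open_comp => // v _; exact: ch.
Qed.

Lemma sqr_lipschitz_continuous n (h : 'cV[R]_n -> R) (K : R) : 0 < K ->
  (forall u v, (h u - h v) ^+ 2 <= K ^+ 2 * dot (u - v) (u - v)) -> continuous h.
Proof.
move=> K0 hK v; apply/(@cvgrPdist_lt _ _ _ (nbhs v) (nbhs_filter v)) => e e0.
(* The topology uses the sup norm, whence the factor [n]. *)
pose r := e / (K * n.+1%:R).
have r0 : 0 < r by rewrite divr_gt0// mulr_gt0.
apply/nbhs_ballP; exists r => //= u [_ uv].
rewrite -(@ltr_pXn2r _ 2)// ?nnegrE ?(ltW e0)// real_normK ?num_real//.
apply: le_lt_trans (hK _ _) _.
have S : dot (v - u) (v - u) <= n%:R * r ^+ 2.
  rewrite dotE; apply: (@le_trans _ _ (\sum_(i < n) r ^+ 2)).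
    apply: ler_sum => i _; rewrite -expr2 !mxE -real_normK ?num_real//.
    by rewrite ler_pXn2r// ?nnegrE ?(ltW r0)//; apply/ltW; exact: uv.
  by rewrite sumr_const card_ord (mulr_natl (r ^+ 2)).
apply: (@le_lt_trans _ _ (K ^+ 2 * (n%:R * r ^+ 2))).
  by rewrite ler_wpM2l ?sqr_ge0.
have -> : e ^+ 2 = K ^+ 2 * (n.+1%:R ^+ 2 * r ^+ 2).
  by rewrite /r; field; rewrite !gt_eqF.
rewrite ltr_pM2l ?exprn_gt0// ltr_pM2r ?exprn_gt0// -natrX ltr_nat.
by rewrite (leq_trans (ltnSn n))// -[X in (X <= _)%N]expn1 leq_pexp2l.
Qed.

End ContinuousMeasurable.

Section CondIndep.
Context {R : realType} {dO : measure_display} {Omega : measurableType dO}.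
Variable P : probability Omega R.
Implicit Types X Y u v : Omega -> R.

Local Notation integ X := (P.-integrable setT (EFin \o X)).
Local Notation Ex X := (Rintegral P setT X).

Variable G : set (set Omega).
Hypothesis hG : Defs.sub_sigma_algebra G.

Local Notation T := (g_sigma_algebraType G).

Let sG : <<s G >> = G.
Proof. by apply: sigma_algebra_id; case: hG. Qed.

Let mG : G `<=` measurable. Proof. by case: hG. Qed.

Let GT : G setT.
Proof. by rewrite -sG; exact: (@measurableT _ T). Qed.

Lemma measurable_wrtP d' (S : measurableType d') (f : Omega -> S) :
  measurable_wrt G f <-> measurable_fun [set: T] f.
Proof.
split=> [mf _ B mB|mf B mB]; first by rewrite setTI /measurable /= sG; exact: mf.
by have := mf measurableT B mB; rewrite setTI /measurable /= sG.
Qed.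

(** [E[X | G] = 0], as a statement on integrals. *)
Definition cond_null X := forall A, G A -> (\int[P]_(w in A) (X w)%:E = 0)%E.

Lemma cond_null_orthogonal X v : integ X -> cond_null X ->
  measurable_fun [set: T] v -> integ (fun w => X w * v w) ->
  Ex (fun w => X w * v w) = 0.
Proof. by move=> iX X0; apply: (generated_orthogonal mG) => // A; rewrite sG; exact: X0. Qed.

Lemma is_cond_exp_null X Y : is_cond_exp P G X Y -> cond_null (fun w => X w - Y w).
Proof.
move=> [iX mY iY XY] A GA; have mA := mG GA.
have iXA := integrableS measurableT mA (@subsetT _ _) iX.
have iYA := integrableS measurableT mA (@subsetT _ _) iY.
have -> : (\int[P]_(w in A) (X w - Y w)%:E =
    \int[P]_(w in A) ((X w)%:E - (Y w)%:E))%E by [].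
by rewrite integralB// XY// subee// integrable_fin_num.
Qed.

(** Orthogonality of [X] to the sign of [v] gives [E |v| <= E (X * sg v) = 0]. *)
Lemma sign_ae0 X v : integ X -> cond_null X -> measurable_fun [set: T] v ->
  (forall w, `|v w| <= X w * Num.sg (v w)) -> {ae P, forall w, v w = 0}.
Proof.
move=> iX X0 mv vX.
have msg : measurable_fun [set: T] (fun w => Num.sg (v w)).
  have -> : (fun w => Num.sg (v w)) =
     (fun w => if v w < 0 then -1 else if 0 < v w then 1 else 0).
    apply/funext => w.
    by case: (ltgtP (v w) 0) => [/ltr0_sg ->|/gtr0_sg ->|->]; rewrite ?sgr0.
  apply: measurable_fun_ifT => //; first exact: measurable_fun_ltr.
  by apply: measurable_fun_ifT => //; exact: measurable_fun_ltr.
have msg' := gen_measurable_fun mG msg.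
have mv' := gen_measurable_fun mG mv.
have iXs : integ (fun w => X w * Num.sg (v w)).
  apply: (@integ_le _ _ _ _ _ (fun w => `|X w|)).
  - by apply: measurable_funM => //; exact: (integ_meas iX).
  - by move=> w; rewrite normrM normr_sg ler_piMr//; case: (_ == _); rewrite ?lexx ?ler01.
  - by have := integrable_abse iX; exact: eq_integrable.
have iv : integ (fun w => `|v w|).
  apply: integ_le iXs; first exact: measurableT_comp.
  by move=> w; rewrite normr_id.
have E0 : Ex (fun w => `|v w|) <= 0.
  by rewrite -(cond_null_orthogonal iX X0 msg iXs); exact: Ex_le.
have mE : measurable_fun [set: Omega] (EFin \o v) by exact/measurable_EFinP.
have /(ae_eq_integral_abs P measurableT mE) :
    (\int[P]_w `|(EFin \o v) w| = 0)%E.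
  have -> : (\int[P]_w `|(EFin \o v) w| = \int[P]_w (`|v w|)%:E)%E by [].
  rewrite ExE//; congr EFin; apply/eqP; rewrite eq_le E0 /=.
  by apply: Rintegral_ge0 => w _.
by apply: filterS => w /(_ I) [].
Qed.

Lemma cond_exp_unique X Y1 Y2 : is_cond_exp P G X Y1 -> is_cond_exp P G X Y2 ->
  {ae P, forall w, Y1 w = Y2 w}.
Proof.
move=> [iX mY1 iY1 h1] [_ mY2 iY2 h2].
have c12 : is_cond_exp P G Y1 Y2 by split=> // A GA; rewrite h1// h2.
have : {ae P, forall w, Y1 w - Y2 w = 0}.
  apply: (sign_ae0 (integB iY1 iY2) (is_cond_exp_null c12)).
    by apply: measurable_funB; exact/measurable_wrtP.
  by move=> w; rewrite mulrC -normrEsg.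
by apply: filterS => w /eqP; rewrite subr_eq0 => /eqP.
Qed.

(** Where [q] leaves [0, 1], the excess [q - clip q] has the sign of [q - 1_A] and at
    most its absolute value, so it vanishes by the sign test. *)
Lemma cond_prob_clip A q : is_cond_exp P G (\1_A) q ->
  {ae P, forall w, q w = Num.max 0 (Num.min 1 (q w))}.
Proof.
move=> hq; have [iA mq iq _] := hq.
have /measurable_wrtP mq' := mq.
have mc : measurable_fun [set: T] (fun w => Num.max 0 (Num.min 1 (q w))).
  by apply: measurable_maxr => //; exact: measurable_minr.
have X0 : cond_null (fun w => q w - \1_A w).
  move=> B GB; have := is_cond_exp_null hq GB => h.
  have mB := mG GB.
  have -> : (\int[P]_(w in B) (q w - \1_A w)%:E =
      \int[P]_(w in B) ((-1)%:E * (\1_A w - q w)%:E))%E.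
    by apply: eq_integral => w _; rewrite -EFinM; congr EFin; ring.
  rewrite integralZl// ?h ?mule0//.
  by apply: (integrableS measurableT mB) => //; exact: (integB iA iq).
have : {ae P, forall w, q w - Num.max 0 (Num.min 1 (q w)) = 0}.
  apply: (sign_ae0 (integB iq iA) X0); first exact: measurable_funB.
  move=> w; have [q0|q0] := ltP (q w) 0.
    rewrite min_r ?max_l ?subr0; [|exact: ltW|by rewrite (le_trans (ltW q0))].
    rewrite ltr0_norm// ltr0_sg// indicE; case: (_ \in _) => /=; lra.
  have [q1|q1] := ltP 1 (q w).
    rewrite max_r ?ler01// gtr0_norm ?gtr0_sg ?subr_gt0//.
    rewrite indicE; case: (_ \in _) => /=; lra.
  by rewrite max_r// subrr normr0 sgr0 mulr0.
by apply: filterS => w /eqP; rewrite subr_eq0 => /eqP.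
Qed.

Section Pair.
Variables (I : finType) (dX : measure_display) (Xi : I -> measurableType dX).
Variable xi : forall i, Omega -> Xi i.
Hypothesis mxi : forall i, measurable_fun setT (xi i).
Hypothesis hind : cond_mutually_independent P G xi.

(** An intersection-stable generator of the sigma-algebra of [G] and [xi i]. *)
Definition rectangles i : set (set Omega) :=
  [set A | exists B (S : set (Xi i)), [/\ G B, measurable S & A = B `&` xi i @^-1` S]].

Let measurable_xi i (S : set (Xi i)) : measurable S -> measurable (xi i @^-1` S).
Proof. by move=> mS; have := @mxi i measurableT S mS; rewrite setTI. Qed.

Let GI A B : G A -> G B -> G (A `&` B).
Proof. by rewrite -sG; exact: (@measurableI _ T). Qed.

Lemma rectangles_measurable i : rectangles i `<=` measurable.
Proof.
move=> _ [B [S [GB mS ->]]]; apply: measurableI; first exact: mG.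
exact: measurable_xi.
Qed.

Lemma rectanglesI i : setI_closed (rectangles i).
Proof.
move=> _ _ [B [S [GB mS ->]]] [B' [S' [GB' mS' ->]]].
exists (B `&` B'), (S `&` S'); split; [exact: GI|exact: measurableI|].
by rewrite preimage_setI setIACA.
Qed.

Lemma rectanglesT i : rectangles i setT.
Proof. by exists setT, setT; split=> //; rewrite preimage_setT setTI. Qed.

Lemma rectangles_wrt d' (S : measurableType d') i (f : Omega -> S) :
  measurable_wrt G f -> measurable_fun [set: g_sigma_algebraType (rectangles i)] f.
Proof.
move=> mf _ B mB; rewrite setTI; apply: sub_sigma_algebra.
by exists (f @^-1` B), setT; split=> //; [exact: mf|rewrite preimage_setT setIT].
Qed.

Lemma rectangles_xi i :
  measurable_fun [set: g_sigma_algebraType (rectangles i)] (xi i).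
Proof.
move=> _ B mB; rewrite setTI; apply: sub_sigma_algebra.
by exists setT, B; split=> //; rewrite setTI.
Qed.

Let dfx i (S : set (Xi i)) (f : forall l, set (Xi l)) : forall l, set (Xi l) :=
  dfwith f i S.

(** The versions given by conditional independence depend on the whole family of
    events. Their uniqueness almost everywhere lets one version [q] serve for all
    events of [xi i], and its bound by one keeps the products integrable. *)
Let factor i j (S : set (Xi j)) : i != j -> measurable S ->
  exists q : Omega -> R,
    [/\ measurable_wrt G q, forall w, 0 <= q w <= 1,
        cond_null (fun w => \1_(xi j @^-1` S) w - q w) &
        forall (S' : set (Xi i)), measurable S' -> forall A, G A ->
        (\int[P]_(w in A) (\1_(xi i @^-1` S') w * \1_(xi j @^-1` S) w)%:E =
         \int[P]_(w in A) (\1_(xi i @^-1` S') w * q w)%:E)%E].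
Proof.
move=> ij mS; have ji : j != i by rewrite eq_sym.
have mB0 l : measurable (@dfx j S (fun=> setT) l).
  by rewrite /dfx; case: dfwithP.
have [p0 [hp0 _]] := hind mB0.
have := hp0 j; rewrite /dfx dfwithin; set q0 := p0 j => hq0.
have [iS mq0 iq0 hq0E] := hq0.
pose q w := Num.max 0 (Num.min 1 (q0 w)).
have q0q := cond_prob_clip hq0.
have mqT : measurable_fun [set: T] q.
  apply: measurable_maxr => //; apply: measurable_minr => //; exact/measurable_wrtP.
have mq : measurable_wrt G q by exact/measurable_wrtP.
have q01 w : 0 <= q w <= 1.
  by rewrite /q le_max lexx /= ge_max ler01 ge_min lexx.
have mq' := gen_measurable_fun mG mqT.
have iq : integ q.
  apply: (integ_le _ _ (integ_cst P 1)) => // w.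
  by have /andP[? ?] := q01 w; rewrite ger0_norm.
have hq : is_cond_exp P G (\1_(xi j @^-1` S)) q.
  split=> // A GA; rewrite -hq0E//; apply: ae_eq_integral; first exact: mG.
  - by apply/measurable_EFinP/measurable_funTS.
  - by apply/measurable_EFinP/measurable_funTS/(integ_meas iq0).
  - by move: q0q; apply: filterS => w E _; rewrite /= /q -E.
exists q; split=> //; first exact: is_cond_exp_null.
move=> S' mS' A GA; have mA := mG GA.
have mB l : measurable (@dfx i S' (@dfx j S (fun=> setT)) l).
  by rewrite /dfx; case: dfwithP => // l' _; case: dfwithP.
have [p [hp hjoint]] := hind mB.
have hpi := hp i; rewrite /dfx dfwithin in hpi.
have hpj := hp j; rewrite /dfx dfwithout// dfwithin in hpj.
have pjq := cond_exp_unique hpj hq.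
have p1 l : l != i -> l != j -> {ae P, forall w, p l w = 1}.
  move=> li lj; have := hp l; rewrite /dfx !dfwithout 1?eq_sym// preimage_setT indicT.
  move=> /cond_exp_unique; apply; split=> //; first exact: (integ_cst P 1).
    by apply/measurable_wrtP; exact: measurable_cst.
  exact: (integ_cst P 1).
have prodE : {ae P, forall w, \prod_l p l w = p i w * q w}.
  have H l : {ae P, forall w, l != i -> l != j -> p l w = 1}.
    have [->|li] := eqVneq l i; first by apply: aeW.
    have [->|lj] := eqVneq l j; first by apply: aeW.
    by have := p1 l li lj; apply: filterS.
  have : {ae P, forall w, forall l, l != i -> l != j -> p l w = 1}.
    by apply: filter_forall => l; exact: H.
  apply: filterS2 pjq => w pq H1.
  rewrite (bigD1 i)//= (bigD1 j)//= big1 ?mulr1 ?pq// => l /andP[li lj].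
  exact: H1.
have [iSi mpi ipi _] := hpi; have [iJ _ iprod hJ] := hjoint.
have mpi' := integ_meas ipi.
have bq (X : Omega -> R) : integ X -> integ (fun w => X w * q w).
  move=> iX; apply: (@integ_le _ _ _ _ _ (fun w => `|X w|)).
  - by apply: measurable_funM => //; exact: (integ_meas iX).
  - move=> w; have /andP[? ?] := q01 w; rewrite normrM ler_piMr//.
    by rewrite ger0_norm.
  - by have := integrable_abse iX; exact: eq_integrable.
transitivity (\int[P]_(w in A) (p i w * q w)%:E)%E.
  transitivity (\int[P]_(w in A) (\prod_l p l w)%:E)%E.
    rewrite hJ//; apply: eq_integral => w _; congr EFin.
    rewrite !indicE -natrM mulnb -in_setI; congr (_ _)%:R.
    have -> : [set w0 | forall l, @dfx i S' (@dfx j S (fun=> setT)) l (xi l w0)] =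
        xi i @^-1` S' `&` xi j @^-1` S.
      apply/seteqP; split=> [w0 h|w0 [h1 h2] l].
        have := h i; have := h j; rewrite /dfx dfwithout// !dfwithin.
        by move=> *; split.
      by rewrite /dfx; case: dfwithP => // l' _; case: dfwithP.
    by [].
  apply: ae_eq_integral => //.
  - by apply/measurable_EFinP/measurable_funTS/(integ_meas iprod).
  - by apply/measurable_EFinP/measurable_funTS/(integ_meas (bq _ ipi)).
  - by move: prodE; apply: filterS => w /= -> _.
have iD := integB iSi ipi.
have D0 : Ex (fun w => (\1_(xi i @^-1` S') w - p i w) * (q w * \1_A w)) = 0.
  apply: (cond_null_orthogonal iD (is_cond_exp_null hpi)).
    apply: measurable_funM => //; apply/measurable_wrtP.
    by apply/measurable_wrtP; apply: measurable_indic; rewrite /measurable /= sG.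
  have := integ_indic mA (bq _ iD); apply: eq_integrable => // w _.
  by rewrite /= mulrA.
rewrite !(integral_indicE P _ mA).
have i1 := integ_indic mA (bq _ iSi).
have i2 := integ_indic mA (bq _ ipi).
rewrite (ExE i1) (ExE i2); congr EFin; apply/eqP; rewrite eq_sym -subr_eq0.
rewrite -[X in _ - X]mul1r -mulNr -(ExZ _ i2) -(ExD i1 (integZ (-1) i2)).
by apply/eqP; rewrite -[RHS]D0; congr Rintegral; apply/funext => w; ring.
Qed.

(** By the pi-lambda argument for [xi j] it suffices that [X] integrates to zero over
    [A `&` xi j @^-1` S] with [A] in [G]. By the same argument for [xi i], the
    indicator of [S] may be replaced there by its conditional probability [q], and
    [X] is orthogonal to functions of the past. *)
Lemma cond_indep_uncorrelated i j X Y : i != j ->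
  measurable_fun [set: g_sigma_algebraType (rectangles i)] X ->
  measurable_fun [set: g_sigma_algebraType (rectangles j)] Y ->
  integ X -> cond_null X -> integ (fun w => X w * Y w) ->
  Ex (fun w => X w * Y w) = 0.
Proof.
move=> ij mX mY iX X0 iXY.
apply: (generated_orthogonal (rectangles_measurable (i := j))) => //.
apply: zero_on_generated => //.
- exact: rectangles_measurable.
- exact: rectanglesI.
- exact: rectanglesT.
move=> _ [A [S [GA mS ->]]]; have mA := mG GA; have mS' := measurable_xi mS.
have mXO := integ_meas iX.
have [q [mq q01 _ hq]] := factor ij mS.
have mqT : measurable_fun [set: T] q by exact/measurable_wrtP.
have mq' := gen_measurable_fun mG mqT.
have iq : integ q.
  apply: (integ_le _ _ (integ_cst P 1)) => // w.
  by have /andP[? ?] := q01 w; rewrite ger0_norm.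
have iS : integ (\1_(xi j @^-1` S) : Omega -> R) by exact: integrable_indic.
pose m w := (\1_(xi j @^-1` S) w - q w) * \1_A w.
have im : integ m by apply: integ_indic => //; exact: integB.
have bnd (b : Omega -> R) : measurable_fun [set: Omega] b ->
    (forall w, `|b w| <= 1) -> integ (fun w => X w * b w).
  move=> mb b1; apply: (@integ_le _ _ _ _ _ (fun w => `|X w|)).
  - exact: measurable_funM.
  - by move=> w; rewrite normrM ler_piMr.
  - by have := integrable_abse iX; exact: eq_integrable.
have ind01 (B : set Omega) w : 0 <= (\1_B w : R) <= 1.
  by rewrite indicE; case: (_ \in _); rewrite /= ?lexx ?ler01.
have iXm : integ (fun w => m w * X w).
  have : integ (fun w => X w * m w).
    apply: bnd; first exact: (integ_meas im).
    move=> w; rewrite /m normrM.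
    have /andP[a0 a1] := ind01 A w; have /andP[s0 s1] := ind01 (xi j @^-1` S) w.
    have /andP[q0 q1] := q01 w; rewrite (ger0_norm a0).
    by rewrite -[leRHS]mulr1 ler_pM// ler_norml; apply/andP; split; lra.
  by apply: eq_integrable => // w _; rewrite /= mulrC.
have E0 : Ex (fun w => m w * X w) = 0.
  apply: (generated_orthogonal (rectangles_measurable (i := i))) => //.
  apply: zero_on_generated => //.
  - exact: rectangles_measurable.
  - exact: rectanglesI.
  - exact: rectanglesT.
  move=> _ [A' [S' [GA' mS2 ->]]].
  have mSi := measurable_xi mS2.
  have mA' := mG GA'.
  have GAA := GI GA GA'; have mAA := mG GAA.
  rewrite integral_indicE; last exact: measurableI.
  have := hq S' mS2 _ GAA.
  have i1 : integ (fun w => \1_(xi i @^-1` S') w * \1_(xi j @^-1` S) w).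
    by apply: integ_indic => //; exact: integrable_indic.
  have i2 : integ (fun w => \1_(xi i @^-1` S') w * q w).
    have := integ_indic mSi iq; apply: eq_integrable => // w _.
    by rewrite /= mulrC.
  rewrite !(integral_indicE P _ mAA) => H.
  have i1' := integ_indic mAA i1; have i2' := integ_indic mAA i2.
  move: H; rewrite (ExE i1') (ExE i2') => -[H].
  have im' : integ (fun w => m w * \1_(A' `&` xi i @^-1` S') w).
    by apply: integ_indic => //; exact: measurableI.
  rewrite (ExE im'); congr EFin.
  have -> : (fun w => m w * \1_(A' `&` xi i @^-1` S') w) = (fun w =>
     \1_(xi i @^-1` S') w * \1_(xi j @^-1` S) w * \1_(A `&` A') w +
     (-1) * (\1_(xi i @^-1` S') w * q w * \1_(A `&` A') w)).
    by apply/funext => w; rewrite /m !indicI /=; ring.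
  by rewrite (ExD i1' (integZ (-1) i2')) (ExZ _ i2') H mulN1r subrr.
have iXq : integ (fun w => X w * (q w * \1_A w)).
  apply: bnd.
    by apply: measurable_funM => //; exact: measurable_indic.
  move=> w; have /andP[a0 a1] := ind01 A w; have /andP[q0 q1] := q01 w.
  by rewrite normrM !ger0_norm// mulr_ile1.
have Eq0 : Ex (fun w => X w * (q w * \1_A w)) = 0.
  apply: cond_null_orthogonal => //; apply: measurable_funM => //.
  by apply: measurable_indic; rewrite /measurable /= sG.
have mAS : measurable (A `&` xi j @^-1` S) by exact: measurableI.
rewrite integral_indicE// (ExE (integ_indic mAS iX)); congr EFin.
have -> : (fun w => X w * \1_(A `&` xi j @^-1` S) w) =
    (fun w => m w * X w + X w * (q w * \1_A w)).
  by apply/funext => w; rewrite /m indicI /=; ring.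
by rewrite (ExD iXm iXq) E0 Eq0 addr0.
Qed.

End Pair.

End CondIndep.

(** * Random vectors and the recursion of gradient tracking *)

Section RandomVectors.
Context {R : realType} {Omega : Type}.

(** Square integrability, alone or together with measurability with respect to the
    past, has this form; stating the closure once lets both propagate through the
    linear operations of the recursion. *)
Definition linear_closed (K : (Omega -> R) -> Prop) : Prop :=
  [/\ forall c, K (fun=> c),
      forall X Y, K X -> K Y -> K (fun w => X w + Y w) &
      forall c X, K X -> K (fun w => c * X w)].

Definition coordinatewise (K : (Omega -> R) -> Prop) n (a : Omega -> 'cV[R]_n) :=
  forall j, K (fun w => a w j 0).

Variable K : (Omega -> R) -> Prop.
Hypothesis hK : linear_closed K.

Local Notation V := (coordinatewise K).

Lemma closed_sum (I : Type) (r : seq I) (X : I -> Omega -> R) :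
  (forall i, K (X i)) -> K (fun w => \sum_(i <- r) X i w).
Proof.
have [Kc KD _] := hK => KX; elim: r => [|i r IH].
  by rewrite (_ : (fun=> _) = fun=> 0)//; apply/funext => w; rewrite big_nil.
rewrite (_ : (fun=> _) = fun w => X i w + \sum_(j <- r) X j w).
  exact: KD.
by apply/funext => w; rewrite big_cons.
Qed.

Lemma vec_cst n (c : 'cV[R]_n) : V (fun=> c).
Proof. by have [Kc _ _] := hK => j; exact: Kc. Qed.

Lemma vecD n (a b : Omega -> 'cV[R]_n) : V a -> V b -> V (fun w => a w + b w).
Proof.
have [_ KD _] := hK => Va Vb j.
rewrite (_ : (fun=> _) = fun w => a w j 0 + b w j 0); first exact: KD.
by apply/funext => w; rewrite mxE.
Qed.

Lemma vecZ n c (a : Omega -> 'cV[R]_n) : V a -> V (fun w => c *: a w).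
Proof.
have [_ _ KZ] := hK => Va j.
rewrite (_ : (fun=> _) = fun w => c * a w j 0); first exact: KZ.
by apply/funext => w; rewrite mxE.
Qed.

Lemma vecB n (a b : Omega -> 'cV[R]_n) : V a -> V b -> V (fun w => a w - b w).
Proof.
move=> Va /(vecZ (-1)) Vb; rewrite (_ : (fun=> _) = fun w => a w + -1 *: b w).
  exact: vecD.
by apply/funext => w; rewrite scaleN1r.
Qed.

Lemma vecM m n (A : 'M[R]_(m, n)) (a : Omega -> 'cV[R]_n) :
  V a -> V (fun w => A *m a w).
Proof.
have [_ _ KZ] := hK => Va j.
rewrite (_ : (fun=> _) = fun w => \sum_l A j l * a w l 0).
  by apply: closed_sum => l; exact: KZ.
by apply/funext => w; rewrite mxE.
Qed.

Lemma vec_sum (I : finType) n (a : I -> Omega -> 'cV[R]_n) :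
  (forall i, V (a i)) -> V (fun w => \sum_i a i w).
Proof.
move=> Va j; rewrite (_ : (fun=> _) = fun w => \sum_i a i w j 0).
  by apply: closed_sum => i; exact: Va.
by apply/funext => w; rewrite summxE.
Qed.

Lemma vec_stack N d (u : 'I_N -> Omega -> 'cV[R]_d) :
  (forall i, V (u i)) -> V (fun w => stack (u ^~ w)).
Proof.
move=> Vu j; rewrite (_ : (fun=> _) =
  fun w => u (mxtens_unindex j).1 w (mxtens_unindex j).2 0); first exact: Vu.
by apply/funext => w; rewrite mxE.
Qed.

Lemma vec_average N d (u : 'I_N -> Omega -> 'cV[R]_d) :
  (forall i, V (u i)) -> V (fun w => average (u ^~ w)).
Proof. by move=> Vu; apply: vecZ; exact: vec_sum. Qed.

End RandomVectors.

Section SquareIntegrableVectors.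
Context {R : realType} {dO : measure_display} {Omega : measurableType dO}.
Variable P : probability Omega R.

Local Notation integ X := (P.-integrable setT (EFin \o X)).
Local Notation sqvec := (coordinatewise (sqint P)).

Lemma sqint_closed : linear_closed (sqint P).
Proof.
split; [exact: sqint_cst| |].
- by move=> X Y; exact: sqintD.
- by move=> c X; exact: sqintZ.
Qed.

Definition sqint_wrt (G : set (set Omega)) (X : Omega -> R) : Prop :=
  measurable_fun [set: g_sigma_algebraType G] X /\ sqint P X.

Lemma sqint_wrt_closed G : linear_closed (sqint_wrt G).
Proof.
split=> [c|X Y [mX sX] [mY sY]|c X [mX sX]]; split.
- exact: measurable_cst.
- exact: sqint_cst.
- exact: measurable_funD.
- exact: sqintD.
- exact: measurable_funM.
- exact: sqintZ.
Qed.

Lemma integ_bil n (A : 'M[R]_n) (a b : Omega -> 'cV[R]_n) :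
  sqvec a -> sqvec b -> integ (fun w => bil A (a w) (b w)).
Proof.
move=> sa sb.
have -> : (fun w => bil A (a w) (b w)) =
    (fun w => \sum_j (\sum_i A^T j i * a w i 0) * b w j 0).
  apply/funext => w; rewrite /bil mxE; apply: eq_bigr => j _; rewrite mxE.
  by congr (_ * _); apply: eq_bigr => i _; rewrite !mxE mulrC.
apply: integ_sum => j; apply: sqint_mul => //.
have := vecM sqint_closed A^T sa j; congr sqint; apply/funext => w.
by rewrite mxE.
Qed.

Lemma integ_dot n (a b : Omega -> 'cV[R]_n) :
  sqvec a -> sqvec b -> integ (fun w => dot (a w) (b w)).
Proof.
move=> sa sb; rewrite (_ : (fun=> _) = fun w => bil 1%:M (a w) (b w)).
  exact: integ_bil.
by apply/funext => w; rewrite dot_bil.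
Qed.

End SquareIntegrableVectors.

Section GradientTrackingAnalysis.
Context {R : realType} {N d : nat} (N_gt0 : (0 < N)%N).
Context {dO dX : measure_display} {Omega : measurableType dO}.
Variable P : probability Omega R.
Context {Xi : 'I_N -> measurableType dX}.
Variables (D : forall i, probability (Xi i) R)
  (F : forall i, 'cV[R]_d -> Xi i -> R).
Hypothesis hF : sampling_model D F.
Variables (L mu : R) (hf : function_assumption D F L mu).
Variables (xstar : 'cV[R]_d) (hxstar : is_minimizer D F xstar).
Variables (W : nat -> 'M[R]_N) (tau : nat) (lambda : R).
Hypothesis hW : network_assumption W tau lambda.
Variables (alpha : R) (x0 : 'I_N -> 'cV[R]_d).
Variables (xi : nat -> forall i : 'I_N, Omega -> Xi i)
  (x g : nat -> 'I_N -> Omega -> 'cV[R]_d).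
Hypothesis hsgt : sgt_iteration F W alpha x0 xi x g.
Variables (Fil : nat -> set (set Omega)) (sigma : R).
Hypothesis hnoise : noise_assumption P D F xi x g Fil sigma.

Local Notation integ X := (P.-integrable setT (EFin \o X)).
Local Notation Ex X := (Rintegral P setT X).
Local Notation sqvec := (coordinatewise (sqint P)).
Local Notation advec k := (coordinatewise (sqint_wrt P (Fil k))).
Local Notation f := (local_objective D F).
Local Notation oracle := (oracle F xi x).
Local Notation noise := (noise D F xi x).
Local Notation Wk k := (kron d (W k)).
Local Notation Wt k := (kron d (W k - avg_mx N)).
Local Notation Rk := (Rmx d W tau lambda).
Local Notation eta := (eta tau lambda).
Local Notation sqn q := (dot q q).

Let L_gt0 : 0 < L.
Proof. by have [/andP[mu0 muL] _] := hf; exact: lt_le_trans muL. Qed.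

Let mu_gt0 : 0 < mu. Proof. by have [/andP[]] := hf. Qed.

Let df i : differentiable_everywhere (f i). Proof. by have [_ /(_ i)[]] := hf. Qed.
Let fL i : smooth L (f i). Proof. by have [_ /(_ i)[]] := hf. Qed.
Let fmu i : strongly_convex mu (f i). Proof. by have [_ /(_ i)[]] := hf. Qed.

Let sum_grad : \sum_i grad (f i) xstar = 0.
Proof. exact: (sum_grad_minimizer N_gt0 L_gt0 df fL hxstar). Qed.

Let grad_err k w : 'cV[R]_(N * d) :=
  stack (fun i => grad (f i) (x k i w) - grad (f i) xstar).

Let noise_vec k w : 'cV[R]_(N * d) := stack (noise k ^~ w).

Let yt k w := ytilde D F xi x g xstar k w.
Let zt k w := zvec D F alpha xi x g tau lambda xstar k w.
Let xh k w := consensus_error (x k ^~ w).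

Let oracle_split k w :
  stack (oracle k ^~ w) - stack (fun i => grad (f i) xstar) =
  grad_err k w + noise_vec k w.
Proof.
rewrite /grad_err /noise_vec stackB stackD; apply: stack_eq => i.
by rewrite /Defs.noise [RHS]addrC addrA subrK.
Qed.

Lemma sum_mixed (A : 'M[R]_N) (u : 'I_N -> 'cV[R]_d) : doubly_stochastic A ->
  \sum_i \sum_j A i j *: u j = \sum_j u j.
Proof.
move=> dsA; rewrite exchange_big /=; apply: eq_bigr => j _.
by rewrite -scaler_suml ds_col_sum// scale1r.
Qed.

(** Mixing preserves sums because the columns of [W k] sum to one, so the tracking
    correction keeps the invariant of the initialization. *)
Lemma tracking_mean k w : \sum_i g k i w = \sum_i oracle k i w.
Proof.
have [_ g0 _ gS] := hsgt; elim: k => [|k IH].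
  by apply: eq_bigr => i _; exact: g0.
under eq_bigr => i _ do rewrite gS.
rewrite sumrB big_split /= sum_mixed ?IH; last exact: (ds_W hW).
by rewrite addrAC subrr add0r.
Qed.

Lemma mean_recursion k w : average (x k.+1 ^~ w) =
  average (x k ^~ w) - alpha *: (average (fun i => grad (f i) (x k i w))
                                 + average (noise k ^~ w)).
Proof.
have [_ _ xS _] := hsgt; rewrite /average.
under eq_bigr => i _ do rewrite xS.
rewrite sum_mixed; last exact: (ds_W hW).
rewrite sumrB -scaler_sumr tracking_mean scalerBr scalerA mulrC -scalerA.
congr (_ - alpha *: _); rewrite -scalerDr; congr (_ *: _).
rewrite -big_split; apply: eq_bigr => i _.
by rewrite /Defs.noise [RHS]addrC subrK.
Qed.

Let kron_avg (u : 'I_N -> 'cV[R]_d) : \sum_i u i = 0 -> kron d (avg_mx N) *m stack u = 0.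
Proof.
move=> u0; rewrite kron_stack; apply: stack_ext => i l; rewrite stackE mxE.
rewrite (_ : \sum_j _ = N%:R^-1 *: \sum_j u j); first by rewrite u0 scaler0 mxE.
by rewrite scaler_sumr; apply: eq_bigr => j _; rewrite !mxE mulr1.
Qed.

Let yt_stack k w :
  yt k w = stack (fun i => g k i w - oracle k i w + grad (f i) xstar).
Proof. by rewrite /yt /ytilde stackB stackD. Qed.

Let Wt_yt k w : Wt k *m yt k w = Wk k *m yt k w.
Proof.
rewrite -kronB mulmxBl [X in _ - X](_ : _ = 0) ?subr0// yt_stack.
apply: kron_avg; rewrite big_split /= sumrB tracking_mean subrr add0r.
exact: sum_grad.
Qed.

(** [Wt] and [W] agree on [yt], whose blocks sum to zero. *)
Lemma yt_recursion k w :
  yt k.+1 w = Wt k *m yt k w - kron d (1%:M - W k) *m (grad_err k w + noise_vec k w).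
Proof.
have [_ _ _ gS] := hsgt.
rewrite Wt_yt -oracle_split -kronB kron1 mulmxBl mul1mx !mulmxBr.
rewrite /yt /ytilde mulmxDr mulmxBr.
have -> : stack (g k.+1 ^~ w) - stack (oracle k.+1 ^~ w) =
    Wk k *m stack (g k ^~ w) - stack (oracle k ^~ w).
  rewrite kron_stack !stackB; apply: stack_eq => i.
  by rewrite gS addrAC addrK.
move: (Wk k *m stack (g k ^~ w)) (stack (oracle k ^~ w)) (stack _) => a b c.
by move: (Wk k *m b) (Wk k *m c) => b' c'; apply/colP => l; rewrite !mxE; ring.
Qed.

Lemma zt_recursion k w :
  zt k.+1 w = Wt k *m zt k w - (alpha / eta) *:
    (kron d (1%:M - W k) *m grad_err k w) - (alpha / eta) *:
    (kron d (1%:M - W k) *m noise_vec k w).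
Proof.
rewrite /zt /zvec -/(yt k.+1 w) -/(yt k w) yt_recursion.
rewrite (mulmxDr (kron d (1%:M - W k))) -scalemxAr scalerBr scalerDr.
by rewrite opprD addrA.
Qed.

(** The tracker satisfies [alpha g = eta z + alpha (grad_err + noise)], and [Wt]
    annihilates averages, so the disagreement obeys a closed recursion. *)
Lemma xh_recursion k w :
  xh k.+1 w = Wt k *m (xh k w - eta *: zt k w - alpha *: grad_err k w)
              - Wt k *m (alpha *: noise_vec k w).
Proof.
have [_ _ xS _] := hsgt; have e0 := eta_gt0 hW; have dsW := ds_W hW k.
have -> : xh k.+1 w = Wt k *m (stack (x k ^~ w) - alpha *: stack (g k ^~ w)).
  rewrite /xh /consensus_error -/(kron d (avg_mx N)) -kron1 kronB.
  have -> : stack (x k.+1 ^~ w) = Wk k *m (stack (x k ^~ w) - alpha *: stack (g k ^~ w)).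
    by rewrite stackZ stackB kron_stack; apply: stack_eq => i; rewrite xS.
  by rewrite mulmxA kronM mulmxBl mul1mx avg_mx_mulr.
have xhE : Wt k *m xh k w = Wt k *m stack (x k ^~ w).
  rewrite /xh /consensus_error -/(kron d (avg_mx N)) -kron1 kronB mulmxA kronM.
  by rewrite mulmxBr mulmx1 mulmxBl avg_mx_mull// avg_mx_idem// subrr subr0.
rewrite -mulmxBr; set q := (X in _ = _ *m X).
have gE : stack (g k ^~ w) = yt k w + (grad_err k w + noise_vec k w).
  rewrite -oracle_split /yt /ytilde.
  move: (stack (g k ^~ w)) (stack (oracle k ^~ w)) => a b.
  by move: (stack _) => c; apply/colP => l; rewrite !mxE; ring.
have ez : eta *: zt k w = alpha *: yt k w.
  by rewrite /zt /zvec scalerA mulrCA mulfV ?gt_eqF// mulr1.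
have -> : q = xh k w - stack (x k ^~ w) +
    (stack (x k ^~ w) - alpha *: stack (g k ^~ w)).
  rewrite /q ez gE; move: (xh k w) (stack (x k ^~ w)) (yt k w) => a b u.
  move: (grad_err k w) (noise_vec k w) => v n.
  by apply/colP => c; rewrite !mxE; ring.
by rewrite (mulmxDr _ (xh k w - _)) (mulmxBr _ (xh k w)) xhE subrr add0r.
Qed.

(** * Measurability and square integrability of the iterates *)

Let hG k : Defs.sub_sigma_algebra (Fil k). Proof. by have [[]] := hnoise k. Qed.

Let mG k : Fil k `<=` measurable. Proof. by have [] := hG k. Qed.

Let xi_wrt s k i : (s < k)%N -> measurable_wrt (Fil k) (xi s i).
Proof. by move=> sk; have [[_ [_ /(_ s i sk)[]]]] := hnoise k. Qed.

Let mxi k i : measurable_fun [set: Omega] (xi k i).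
Proof.
apply: (gen_measurable_fun (@mG k.+1)); apply/(measurable_wrtP (hG k.+1)).
exact: xi_wrt.
Qed.

Let oracle_meas d' (T : measurableType d') (p : T -> 'cV[R]_d) i (s : T -> Xi i) j :
  (forall l, measurable_fun [set: T] (fun w => p w l 0)) ->
  measurable_fun [set: T] s ->
  measurable_fun [set: T] (fun w => stoch_grad F (p w) (s w) j 0).
Proof.
move=> mp ms; have [_ _ mF] := hF i.
pose t w : d.-tuple R * Xi i := ([tuple p w l 0 | l < d], s w).
have -> : (fun w => stoch_grad F (p w) (s w) j 0) =
   (fun q : d.-tuple R * Xi i => stoch_grad F (\col_l tnth q.1 l) q.2 j 0) \o t.
  apply/funext => w; rewrite /comp.
  have -> // : \col_l tnth (t w).1 l = p w.
  by apply/colP => l; rewrite mxE tnth_mktuple.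
apply: measurableT_comp (mF j) _; apply: measurable_fun_pair => //.
apply/measurable_fun_tnthP => l.
rewrite (_ : _ \o _ = fun w => p w l 0)//.
by apply/funext => w /=; rewrite tnth_mktuple.
Qed.

Let grad_meas d' (T : measurableType d') (p : T -> 'cV[R]_d) i j :
  (forall l, measurable_fun [set: T] (fun w => p w l 0)) ->
  measurable_fun [set: T] (fun w => grad (f i) (p w) j 0).
Proof.
move=> mp; apply: (continuous_coord_measurable (h := fun v => grad (f i) v j 0)) mp _.
apply: (sqr_lipschitz_continuous L_gt0) => u v.
apply: le_trans (smooth_sqr L_gt0 (fL i) u v).
rewrite dotE (bigD1 j)//= -expr2 !mxE lerDl.
by apply: sumr_ge0 => l _; rewrite -expr2 sqr_ge0.
Qed.

Let noise_facts k i j :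
  [/\ integ (fun w => noise k i w j 0), cond_null P (Fil k) (fun w => noise k i w j 0)
    & sqint P (fun w => noise k i w j 0)].
Proof.
have [_ _ /(_ i j) hc /(_ i) [Y [[i2 _ _ _] _]]] := hnoise k.
have [i1 _ _ h0] := hc; split=> //.
- move=> A GA; rewrite -h0//.
  have -> : (fun w => (cst 0 w)%:E) = cst 0%E :> (Omega -> \bar R) by [].
  exact: integral0.
- apply: sqint_le i2; first exact: (integ_meas i1).
  move=> w; rewrite l2norm_sqr dotE (bigD1 j)//= -expr2 lerDl.
  by apply: sumr_ge0 => l _; rewrite -expr2 sqr_ge0.
Qed.

Let noise_sq k i : sqvec (noise k i).
Proof. by move=> j; have [] := noise_facts k i j. Qed.

Let noise_var k i : Ex (fun w => sqn (noise k i w)) <= sigma ^+ 2.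
Proof.
have [_ _ _ /(_ i) [Y [[i2 mY iY hY] Ys]]] := hnoise k.
have i2' := integ_dot (noise_sq k i) (noise_sq k i).
have GT : Fil k setT.
  have <- : <<s Fil k >> = Fil k by apply: sigma_algebra_id; case: (hG k).
  exact: (@measurableT _ (g_sigma_algebraType (Fil k))).
have -> : Ex (fun w => sqn (noise k i w)) = Ex Y.
  apply: EFin_inj; rewrite -!ExE// hY//.
  by apply: eq_integral => w _; rewrite l2norm_sqr.
have mY' := integ_meas iY.
have iM : integ (fun w => Num.min (Y w) (sigma ^+ 2)).
  apply: (@integ_le _ _ _ _ _ (fun w => `|Y w| + sigma ^+ 2)).
  - exact: measurable_minr.
  - move=> w; have s0 := sqr_ge0 sigma.
    by case: (leP (Y w) (sigma ^+ 2)) => _; rewrite ?lerDl// ger0_norm// lerDr.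
  - apply: integD; last exact: integ_cst.
    by have := integrable_abse iY; exact: eq_integrable.
have -> : Ex Y = Ex (fun w => Num.min (Y w) (sigma ^+ 2)).
  apply: EFin_inj; rewrite -!ExE//; apply: ae_eq_integral => //.
  - exact/measurable_EFinP.
  - exact: measurable_int iM.
  - by move: Ys; apply: filterS => w Yw _; rewrite min_l.
rewrite -[leRHS](Ex_cst P); apply: Ex_le => //; first exact: integ_cst.
by move=> w; rewrite ge_min lexx orbT.
Qed.

Let x_adapted k i j : measurable_fun [set: g_sigma_algebraType (Fil k)]
  (fun w => x k i w j 0).
Proof.
have [[_ [mx _]] _ _ _] := hnoise k.
by apply/(measurable_wrtP (hG k)); exact: mx.
Qed.

(* A Lipschitz gradient grows at most linearly. *)
Let grad_sq k i : sqvec (x k i) -> sqvec (fun w => grad (f i) (x k i w)).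
Proof.
move=> sx j.
apply: (@sqint_le _ _ _ _ _ (fun w => 2 * (L ^+ 2 * sqn (x k i w)) + 2 * sqn (grad (f i) 0))).
- by apply: grad_meas => l; have [] := sx l.
- move=> w; apply: (@le_trans _ _ (sqn (grad (f i) (x k i w)))).
    rewrite dotE (bigD1 j)//= -expr2 lerDl.
    by apply: sumr_ge0 => l _; rewrite -expr2 sqr_ge0.
  rewrite -[X in sqn X <= _](subrK (grad (f i) 0)).
  apply: le_trans (dot_two _ _) _; rewrite lerD2r ler_pM2l//.
  by have := smooth_sqr L_gt0 (fL i) (x k i w) 0; rewrite subr0.
- apply: integD; last exact: integ_cst.
  by apply/integZ/integZ; exact: integ_dot.
Qed.

Let oracle_sq k i : sqvec (x k i) -> sqvec (oracle k i).
Proof.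
move=> sx; have := vecD (sqint_closed P) (noise_sq k i) (grad_sq sx).
by congr sqvec; apply/funext => w; rewrite /Defs.noise subrK.
Qed.

Lemma iterates_sqint k : (forall i, sqvec (x k i)) /\
  (forall i, sqvec (fun w => g k i w - oracle k i w)).
Proof.
have sc := sqint_closed P; have [xE gE xS gS] := hsgt.
elim: k => [|k [sx sy]].
  split=> i; first by rewrite (_ : x 0 i = fun=> x0 i);
    [exact: vec_cst|apply/funext => w; exact: xE].
  rewrite (_ : (fun=> _) = fun=> 0); first exact: vec_cst.
  by apply/funext => w; rewrite gE subrr.
have so i := oracle_sq (sx i).
have sg i : sqvec (g k i).
  have := vecD sc (sy i) (so i); congr sqvec; apply/funext => w.
  by rewrite subrK.
split=> i.
  rewrite (_ : x k.+1 i = fun w => \sum_j W k i j *: (x k j w - alpha *: g k j w)).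
    by apply: (vec_sum sc) => j; apply/(vecZ sc)/(vecB sc) => //; exact: vecZ.
  by apply/funext => w; exact: xS.
rewrite (_ : (fun=> _) = fun w => \sum_j W k i j *: g k j w - oracle k i w).
  by apply: (vecB sc) => //; apply: (vec_sum sc) => j; exact: vecZ.
by apply/funext => w; rewrite gS addrAC addrK.
Qed.

Let x_advec k i : advec k (x k i).
Proof. by move=> j; split; [exact: x_adapted|have [+ _] := iterates_sqint k; exact]. Qed.

Let grad_advec k i : advec k (fun w => grad (f i) (x k i w)).
Proof.
move=> j; split; first exact: (grad_meas _ _ (@x_adapted k i)).
by have [sx _] := iterates_sqint k; exact: grad_sq.
Qed.

(** The tracker without its newest gradient only involves past samples. *)
Lemma tracker_advec k i : advec k (fun w => g k i w - oracle k i w).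
Proof.
move=> j; split; last by have [_ sy] := iterates_sqint k; exact: sy.
have [_ gE _ gS] := hsgt; case: k => [|k].
  rewrite (_ : (fun=> _) = fun=> 0); first exact: measurable_cst.
  by apply/funext => w; rewrite gE subrr mxE.
have [[_ [_ past]] _ _ _] := hnoise k.+1.
have mg i' l : measurable_fun [set: g_sigma_algebraType (Fil k.+1)]
    (fun w => g k i' w l 0).
  have [_ _ mg] := past k i' (ltnSn k).
  by apply/(measurable_wrtP (hG k.+1)); exact: mg.
have [mxi' mx' _] := past k i (ltnSn k).
rewrite (_ : (fun=> _) = fun w =>
   \sum_i' W k i i' * g k i' w j 0 - oracle k i w j 0).
  apply: measurable_funB.
    by apply: measurable_sum => i'; exact: measurable_funM.
  apply: oracle_meas; last by apply/(measurable_wrtP (hG k.+1)).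
  by move=> l; apply/(measurable_wrtP (hG k.+1)); exact: mx'.
apply/funext => w; rewrite gS addrAC addrK mxE summxE [X in _ + X]mxE.
by congr (_ - _); apply: eq_bigr => i' _; rewrite mxE.
Qed.

Let grad_err_advec k : advec k (grad_err k).
Proof.
have ac := sqint_wrt_closed P (Fil k).
by apply: (vec_stack) => i; apply: (vecB ac); [exact: grad_advec|exact: vec_cst].
Qed.

Let zt_advec k : advec k (zt k).
Proof.
have ac := sqint_wrt_closed P (Fil k).
rewrite (_ : zt k = fun w => (alpha / eta) *:
  stack (fun i => g k i w - oracle k i w + grad (f i) xstar)).
  apply: (vecZ ac); apply: vec_stack => i.
  by apply: (vecD ac); [exact: tracker_advec|exact: vec_cst].
by apply/funext => w; rewrite -yt_stack.
Qed.

Let xh_advec k : advec k (xh k).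
Proof.
have ac := sqint_wrt_closed P (Fil k).
by apply: (vecM ac); apply: vec_stack => i; exact: x_advec.
Qed.

Let sq_of_ad k n (a : Omega -> 'cV[R]_n) : advec k a -> sqvec a.
Proof. by move=> ha j; have [] := ha j. Qed.

Let noise_vec_sq k : sqvec (noise_vec k).
Proof. by apply: vec_stack => i; exact: noise_sq. Qed.

Lemma noise_orthogonal k (a : Omega -> 'cV[R]_(N * d)) : advec k a ->
  Ex (fun w => dot (a w) (noise_vec k w)) = 0.
Proof.
move=> ha.
have E : (fun w => dot (a w) (noise_vec k w)) =
    (fun w => \sum_c noise_vec k w c 0 * a w c 0).
  by apply/funext => w; rewrite dotC dotE.
have i1 c : integ (fun w => noise_vec k w c 0 * a w c 0).
  by apply: sqint_mul; [exact: noise_vec_sq|exact: sq_of_ad].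
rewrite E Ex_sum// big1// => c _.
have [i0 c0 _] := noise_facts k (mxtens_unindex c).1 (mxtens_unindex c).2.
have nE : (fun w => noise_vec k w c 0) =
    (fun w => noise k (mxtens_unindex c).1 w (mxtens_unindex c).2 0).
  by apply/funext => w; rewrite mxE.
have i2 := i1 c.
apply: (cond_null_orthogonal (hG k) (X := fun w => noise_vec k w c 0)).
- by rewrite nE.
- by rewrite nE.
- by have [] := ha c.
- exact: i2.
Qed.

Lemma noise_uncorrelated k i i' : i != i' ->
  Ex (fun w => dot (noise k i w) (noise k i' w)) = 0.
Proof.
move=> ii'.
have [_ hind _ _] := hnoise k; have [[_ [mx _]] _ _ _] := hnoise k.
have mn l j : measurable_fun [set: g_sigma_algebraType (rectangles (Fil k) (xi k) l)]
    (fun w => noise k l w j 0).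
  have mx' q : measurable_fun
      [set: g_sigma_algebraType (rectangles (Fil k) (xi k) l)] (fun w => x k l w q 0).
    by apply: rectangles_wrt; exact: mx.
  rewrite (_ : (fun=> _) = fun w => oracle k l w j 0 - grad (f l) (x k l w) j 0).
    apply: measurable_funB; last exact: grad_meas.
    by apply: oracle_meas => //; apply: (rectangles_xi (hG k)).
  by apply/funext => w; rewrite !mxE.
rewrite (_ : (fun=> _) = fun w => \sum_j noise k i w j 0 * noise k i' w j 0); last first.
  by apply/funext => w; rewrite dotE.
have i1 j : integ (fun w => noise k i w j 0 * noise k i' w j 0).
  by apply: sqint_mul; exact: noise_sq.
rewrite Ex_sum// big1// => j _; have [i0 c0 _] := noise_facts k i j.
exact: (cond_indep_uncorrelated (hG k) (mxi k) hind ii' (mn i j) (mn i' j)).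
Qed.

(** The mixed terms vanish by conditional independence, which leaves [N] of the
    [N ^+ 2] terms and yields the linear speedup of the noise floor. *)
Lemma mean_noise_var k :
  Ex (fun w => sqn (average (noise k ^~ w))) <= sigma ^+ 2 / N%:R.
Proof.
have N0 : 0 < N%:R :> R by rewrite ltr0n.
have i1 i i' : integ (fun w => dot (noise k i w) (noise k i' w)).
  by apply: integ_dot; exact: noise_sq.
have i2 i : integ (fun w => \sum_i' dot (noise k i w) (noise k i' w)).
  exact: integ_sum.
rewrite (_ : (fun=> _) = fun w => (N%:R^-1 * N%:R^-1) *
    \sum_i \sum_i' dot (noise k i w) (noise k i' w)); last first.
  apply/funext => w; rewrite dotZl dotZr mulrA; congr (_ * _).
  rewrite (dot_suml (noise k ^~ w)); apply: eq_bigr => i _.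
  by rewrite dotC (dot_suml (noise k ^~ w)); apply: eq_bigr => i' _; exact: dotC.
rewrite ExZ; last exact: integ_sum.
rewrite Ex_sum//; under eq_bigr => i _ do rewrite Ex_sum//.
have H i : \sum_i' Ex (fun w => dot (noise k i w) (noise k i' w)) <= sigma ^+ 2.
  rewrite (bigD1 i)//= big1 ?addr0; first exact: noise_var.
  by move=> i' i'i; apply: noise_uncorrelated; rewrite eq_sym.
apply: (@le_trans _ _ (N%:R^-1 * N%:R^-1 * \sum_(i < N) sigma ^+ 2)).
  by rewrite ler_wpM2l ?mulr_ge0 ?invr_ge0 ?ler0n// ler_sum.
rewrite sumr_const card_ord -(mulr_natr (sigma ^+ 2)) le_eqVlt; apply/orP; left.
by apply/eqP; field; rewrite gt_eqF.
Qed.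

Lemma total_noise_var k : Ex (fun w => sqn (noise_vec k w)) <= N%:R * sigma ^+ 2.
Proof.
have i1 i : integ (fun w => sqn (noise k i w)) by apply: integ_dot; exact: noise_sq.
rewrite (_ : (fun=> _) = fun w => \sum_i sqn (noise k i w)); last first.
  by apply/funext => w; rewrite dot_stack.
rewrite Ex_sum//; apply: (@le_trans _ _ (\sum_(i < N) sigma ^+ 2)).
  by apply: ler_sum => i _; exact: noise_var.
by rewrite sumr_const card_ord mulr_natl.
Qed.

Section Descent.
Hypothesis halpha : 0 < alpha <= alpha_bar L mu tau lambda.

Local Notation dlt := (delta tau lambda).
Local Notation Q := (Qcst tau lambda).
Let omega := 16 * alpha * L / dlt.

Let mean_err k w := average (x k ^~ w) - xstar.

Let energy k w := qform (Rk k) (xh k w) + 2 * qform (Rk k) (zt k w).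

Definition lyap k w : R := sqn (mean_err k w) + omega * (N%:R^-1 * energy k w).

Let mean_pred k w :=
  mean_err k w - alpha *: average (fun i => grad (f i) (x k i w)).
Let xh_pred k w := Wt k *m (xh k w - eta *: zt k w - alpha *: grad_err k w).
Let zt_pred k w :=
  Wt k *m zt k w - (alpha / eta) *: (kron d (1%:M - W k) *m grad_err k w).

(** The value after one step if the stochastic gradients were exact. *)
Let lyap_pred k w := sqn (mean_pred k w) + omega * (N%:R^-1 *
  (qform (Rk k.+1) (xh_pred k w) + 2 * qform (Rk k.+1) (zt_pred k w))).

(** The part of the step that is linear in the noise, arranged so that each term
    pairs the noise with a vector determined by the past. *)
Let cross k w :=
  - 2 * alpha * dot (stack (fun i : 'I_N => N%:R^-1 *: mean_pred k w)) (noise_vec k w)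
  + omega * (N%:R^-1 * (
     - 2 * alpha * dot ((Wt k)^T *m ((Rk k.+1)^T *m xh_pred k w)) (noise_vec k w)
     - 4 * (alpha / eta) *
       dot ((kron d (1%:M - W k))^T *m ((Rk k.+1)^T *m zt_pred k w)) (noise_vec k w))).

Let bil_mulr n (A B : 'M[R]_n) a s : bil A a (B *m s) = dot (B^T *m (A^T *m a)) s.
Proof. by rewrite /bil /dot !trmx_mul !trmxK !mulmxA. Qed.

Let lyap_step k w : lyap k.+1 w <=
  lyap_pred k w + cross k w
  + (alpha ^+ 2 * sqn (average (noise k ^~ w))
     + omega * (N%:R^-1 * (alpha ^+ 2 * Q * sqn (noise_vec k w)))).
Proof.
have N0 : 0 < N%:R :> R by rewrite ltr0n.
have mE : mean_err k.+1 w = mean_pred k w - alpha *: average (noise k ^~ w).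
  rewrite /mean_err mean_recursion /mean_pred /mean_err scalerDr opprD addrA.
  by rewrite [LHS]addrAC; congr (_ - _); rewrite [LHS]addrAC.
have cE : dot (stack (fun i : 'I_N => N%:R^-1 *: mean_pred k w)) (noise_vec k w) =
    dot (mean_pred k w) (average (noise k ^~ w)).
  rewrite dot_stack dotC dotZl (dot_suml (noise k ^~ w)) mulr_sumr.
  by apply: eq_bigr => i _; rewrite dotZl dotC.
have noise_le := noise_step hW alpha k (noise_vec k w).
have sR := Rmx_sym d hW k.+1.
rewrite /lyap /lyap_pred /cross /energy cE mE xh_recursion zt_recursion.
rewrite -/(xh_pred k w) -/(zt_pred k w).
rewrite -!bil_mulr.
move: noise_le.
move: (mean_pred k w) (average (noise k ^~ w)) (xh_pred k w) (zt_pred k w) => m s p q.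
rewrite -scalemxAr; move: (Wt k *m noise_vec k w) (kron d _ *m noise_vec k w) => u v.
rewrite !qformE !(dotDl, dotDr, dotNl, dotNr, dotZl, dotZr).
rewrite !(bilDl, bilDr, bilNl, bilNr, bilZl, bilZr).
rewrite (dotC s m) (bil_sym u p sR) (bil_sym v q sR).
have w0 : 0 <= omega * N%:R^-1.
  rewrite mulr_ge0 ?invr_ge0 ?ler0n// divr_ge0 ?(ltW (delta_gt0 hW))//.
  by have /andP[a0 _] := halpha; rewrite !mulr_ge0// ltW.
move=> /(ler_wpM2l w0); rewrite -subr_ge0 => h; rewrite -subr_ge0.
by move: h; congr (0 <= _); ring.
Qed.

Let xhE k w : sqn (xh k w) =
  \sum_i sqn (x k i w - average (x k ^~ w)).
Proof.
rewrite /xh /consensus_error -/(kron d (avg_mx N)) mulmxBl mul1mx kron_stack stackB.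
rewrite dot_stack; apply: eq_bigr => i _.
have -> : \sum_j avg_mx N i j *: x k j w = average (x k ^~ w).
  by rewrite /average scaler_sumr; apply: eq_bigr => j _; rewrite !mxE mulr1.
by [].
Qed.

(** The noiseless part contracts for every outcome, before any expectation. *)
Let contraction k w : lyap_pred k w <= (1 - mu * alpha / 2) * lyap k w.
Proof.
have N0 : 0 < N%:R :> R by rewrite ltr0n.
have Ni : 0 <= N%:R^-1 :> R by rewrite invr_ge0 ltW.
have hmu : 0 < mu <= L by have [] := hf.
have /andP[a0 _] := halpha.
have aL := stepsize_le hW hmu halpha; have d1 := delta_le1 hW.
have aL0 : 0 < alpha * L by rewrite mulr_gt0.
pose C := N%:R^-1 * sqn (xh k w); pose Z := N%:R^-1 * sqn (zt k w).
pose B := N%:R^-1 * sqn (grad_err k w).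
have := @combine_steps _ _ _ _ _ hW L mu alpha hmu halpha
  (sqn (mean_err k w)) (sqn (mean_pred k w)) C Z B
  (N%:R^-1 * qform (Rk k) (xh k w)) (N%:R^-1 * qform (Rk k) (zt k w))
  (N%:R^-1 * qform (Rk k.+1) (xh_pred k w)) (N%:R^-1 * qform (Rk k.+1) (zt_pred k w)).
rewrite /lyap_pred /lyap /energy -/omega.
rewrite 2!(mulrCA 2 N%:R^-1) -2!(mulrDr N%:R^-1); apply.
- exact: dot_ge0.
- by rewrite mulr_ge0// dot_ge0.
- by rewrite mulr_ge0// dot_ge0.
- by rewrite ler_wpM2l// Rmx_le.
- by rewrite ler_wpM2l// Rmx_le.
- rewrite /C xhE; apply: (mean_step N_gt0 mu_gt0 L_gt0 df fL fmu hxstar) => //.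
    exact: ltW.
  by rewrite -mulrA; lra.
- rewrite /B /C xhE dot_stack -(average_bias_variance N_gt0 (x k ^~ w) xstar).
  exact: (grad_diff_sqr_le L_gt0 fL).
- have := ler_wpM2l Ni (lyapunov_step hW k (xh k w) (zt k w) (grad_err k w) (ltW a0)).
  rewrite -/(xh_pred k w) -/(zt_pred k w) /C /Z /B.
  move: (qform _ (xh_pred k w)) (qform _ (zt_pred k w)) => e1 e2.
  move: (qform _ (xh k w)) (qform _ (zt k w)) (sqn (xh k w)) => e3 e4 e5.
  move: (sqn (zt k w)) (sqn (grad_err k w)) (15 + _) => e6 e7 c h.
  rewrite -subr_ge0; rewrite -subr_ge0 in h.
  by move: h; congr (0 <= _); ring.
Qed.

Let xh_sq k : sqvec (xh k). Proof. exact: (sq_of_ad (@xh_advec k)). Qed.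
Let zt_sq k : sqvec (zt k). Proof. exact: (sq_of_ad (@zt_advec k)). Qed.

Let mean_err_advec k : advec k (mean_err k).
Proof.
have ac := sqint_wrt_closed P (Fil k).
by apply: (vecB ac); [apply: (vec_average ac) => i; exact: x_advec|exact: vec_cst].
Qed.

Let energy_integ k : integ (energy k).
Proof. by apply: integD; [|apply: integZ]; exact: integ_bil. Qed.

Let mean_err_integ k : integ (fun w => sqn (mean_err k w)).
Proof. by apply: integ_dot; exact: (sq_of_ad (@mean_err_advec k)). Qed.

Lemma lyap_integ k : integ (lyap k).
Proof.
by apply: integD; [exact: mean_err_integ|apply/integZ/integZ; exact: energy_integ].
Qed.

Lemma VlyapE k :
  Vlyap P D F W alpha xi x g tau lambda xstar L k = (Ex (lyap k))%:E.
Proof.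
have iN := integZ N%:R^-1 (energy_integ k).
rewrite (ExD (mean_err_integ k) (integZ omega iN)) ExZ// ExZ; last exact: energy_integ.
rewrite /Vlyap /Xtilde /Eerr unlock EFinD !EFinM -ExE; last exact: mean_err_integ.
rewrite -(ExE (energy_integ k)); congr (_ + _)%E.
by apply: eq_integral => w _; rewrite l2norm_sqr.
Qed.

Let mean_pred_advec k : advec k (mean_pred k).
Proof.
have ac := sqint_wrt_closed P (Fil k).
apply: (vecB ac); first exact: mean_err_advec.
by apply: (vecZ ac); apply: (vec_average ac) => i; exact: grad_advec.
Qed.

Let xh_pred_advec k : advec k (xh_pred k).
Proof.
have ac := sqint_wrt_closed P (Fil k).
apply: (vecM ac); apply: (vecB ac); last by apply: (vecZ ac); exact: grad_err_advec.
by apply: (vecB ac); [exact: xh_advec|apply: (vecZ ac); exact: zt_advec].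
Qed.

Let zt_pred_advec k : advec k (zt_pred k).
Proof.
have ac := sqint_wrt_closed P (Fil k).
apply: (vecB ac); first by apply: (vecM ac); exact: zt_advec.
by apply/(vecZ ac)/(vecM ac); exact: grad_err_advec.
Qed.

Let cross_zero k : integ (cross k) /\ Ex (cross k) = 0.
Proof.
have ac := sqint_wrt_closed P (Fil k).
have h1 : advec k (fun w => stack (fun i : 'I_N => N%:R^-1 *: mean_pred k w)).
  by apply: vec_stack => i; apply: (vecZ ac); exact: mean_pred_advec.
have h2 : advec k (fun w => (Wt k)^T *m ((Rk k.+1)^T *m xh_pred k w)).
  by apply/(vecM ac)/(vecM ac); exact: xh_pred_advec.
have h3 : advec k (fun w =>
    (kron d (1%:M - W k))^T *m ((Rk k.+1)^T *m zt_pred k w)).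
  by apply/(vecM ac)/(vecM ac); exact: zt_pred_advec.
have i a : advec k a -> integ (fun w => dot (a w) (noise_vec k w)).
  by move=> ha; apply: integ_dot; [exact: sq_of_ad ha|exact: noise_vec_sq].
have j2 := integZ (- 2 * alpha) (i _ h2).
have j3 := integZ (4 * (alpha / eta)) (i _ h3).
have j23 := integZ N%:R^-1 (integB j2 j3).
have j1 := integZ (- 2 * alpha) (i _ h1).
split; first by apply: integD => //; exact: integZ.
rewrite (ExD j1 (integZ omega j23)) ExZ; last exact: i.
rewrite (ExZ _ j23) (ExZ _ (integB j2 j3)) (ExD j2 (integN j3)).
rewrite (ExZ _ (i _ h2)) !noise_orthogonal//.
rewrite (_ : (fun w => - _) = fun w => - (4 * (alpha / eta)) *
   dot ((kron d (1%:M - W k))^T *m ((Rk k.+1)^T *m zt_pred k w)) (noise_vec k w)).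
  by rewrite ExZ ?noise_orthogonal//; [ring|exact: i].
by apply/funext => w; rewrite mulNr.
Qed.

Lemma lyap_decrease k : Ex (lyap k.+1) <= (1 - mu * alpha / 2) * Ex (lyap k)
  + (alpha ^+ 2 * sigma ^+ 2 / N%:R
     + 16 * alpha ^+ 3 * L * Q * sigma ^+ 2 / dlt).
Proof.
have N0 : 0 < N%:R :> R by rewrite ltr0n.
have d0 := delta_gt0 hW; have /andP[a0 _] := halpha.
have Q0 : 0 <= Q by apply: le_trans (Qcst_ge hW).
have [ic c0] := cross_zero k.
have i1 := integZ (1 - mu * alpha / 2) (lyap_integ k).
have is1 : integ (fun w => sqn (average (noise k ^~ w))).
  by apply: integ_dot; apply: (vec_average (sqint_closed P)) => i; exact: noise_sq.
have is2 : integ (fun w => sqn (noise_vec k w)).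
  by apply: integ_dot; exact: noise_vec_sq.
have iA := integZ (alpha ^+ 2) is1.
have iB := integZ (alpha ^+ 2 * Q) is2.
have iB' := integZ omega (integZ N%:R^-1 iB).
have := Ex_le (lyap_integ k.+1) (integD (integD i1 ic) (integD iA iB')).
rewrite (ExD (integD i1 ic) (integD iA iB')) (ExD i1 ic) (ExD iA iB') c0 addr0.
rewrite (ExZ _ (lyap_integ k)) (ExZ _ is1) (ExZ _ (integZ N%:R^-1 iB)) (ExZ _ iB) (ExZ _ is2).
move=> /(_ _) h; apply: le_trans (h _) _.
  move=> w; apply: le_trans (lyap_step k w) _.
  by rewrite !lerD2r contraction.
rewrite lerD2l lerD//.
  by rewrite -mulrA ler_wpM2l ?sqr_ge0// mean_noise_var.
have w0 : 0 <= omega.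
  by rewrite divr_ge0 ?(ltW d0)// mulr_ge0 ?(ltW L_gt0)// mulr_ge0 ?(ltW a0).
have := total_noise_var k => hs.
apply: (@le_trans _ _ (omega * (N%:R^-1 * (alpha ^+ 2 * Q * (N%:R * sigma ^+ 2))))).
  apply: ler_wpM2l => //; apply: ler_wpM2l; first by rewrite invr_ge0 ltW.
  by apply: ler_wpM2l => //; rewrite mulr_ge0 ?sqr_ge0.
rewrite le_eqVlt; apply/orP; left; apply/eqP; rewrite /omega.
by field; rewrite !gt_eqF.
Qed.

End Descent.

End GradientTrackingAnalysis.

Theorem theorem1 (R : realType) (N d : nat) (hN : (1 <= N)%N) (hd : (1 <= d)%N)
  (dO dX : measure_display) (Omega : measurableType dO)
  (P : probability Omega R)
  (Xi : 'I_N -> measurableType dX)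
  (D : forall i, probability (Xi i) R)
  (F : forall i, 'cV[R]_d -> Xi i -> R)
  (hF : sampling_model D F)
  (L mu : R) (hf : function_assumption D F L mu)
  (xstar : 'cV[R]_d) (hxstar : is_minimizer D F xstar)
  (W : nat -> 'M[R]_N) (tau : nat) (lambda : R)
  (hW : network_assumption W tau lambda)
  (alpha : R) (x0 : 'I_N -> 'cV[R]_d)
  (xi : nat -> forall i : 'I_N, Omega -> Xi i)
  (x g : nat -> 'I_N -> Omega -> 'cV[R]_d)
  (hsgt : sgt_iteration F W alpha x0 xi x g)
  (Fil : nat -> set (set Omega)) (sigma : R)
  (hnoise : noise_assumption P D F xi x g Fil sigma)
  (halpha : 0 < alpha <= alpha_bar L mu tau lambda) :
  let V := Vlyap P D F W alpha xi x g tau lambda xstar L in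
  forall k : nat,
    (V k.+1 <= (1 - mu * alpha / 2)%:E * V k
               + (alpha ^+ 2 * sigma ^+ 2 / N%:R
                  + 16 * alpha ^+ 3 * L * Qcst tau lambda * sigma ^+ 2
                    / delta tau lambda)%:E)%E.
Proof.
move=> V k; rewrite /V !(VlyapE hF hf _ _ _ hsgt hnoise) -EFinM -EFinD lee_fin.
exact: (lyap_decrease hN hF hf hxstar hW hsgt hnoise halpha).
Qed.
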